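(* Let $\mathcal{O}$ be a maximal order in an indefinite quaternion algebra $A$ over a number field $K$, let $\mathfrak{p}$ be a prime of $\mathbb{Z}_K$ that splits in $A$, and let a $\mathfrak{p}$-reduction structure be given. Then the algorithm PReduce of the context is correct: for every integral right $\mathcal{O}$-ideal $I$, it terminates and outputs an integer $r$, an element $c\in A^\times$ and an integral right $\mathcal{O}$-ideal $J$ such that $cI=J\mathfrak{p}^r$ and $v_{\mathfrak{p}}(\mathrm{nrd}(J))\in\{0,1\}$.
   Context: $K$ is a number field with ring of integers $\mathbb{Z}_K$; $A$ is a quaternion algebra over $K$ with reduced norm $\mathrm{nrd}$; a place $v$ of $K$ is split if $A\otimes_K K_v\cong M_2(K_v)$, and $A$ is indefinite if some infinite place is split. A lattice is a finitely generated $\mathbb{Z}_K$-submodule $I\subset A$ with $KI=A$; $\mathcal{O}_r(I)=\{x\in A: Ix\subset I\}$ and $\mathcal{O}_l(I)=\{x\in A: xI\subset I\}$. A right $\mathcal{O}$-ideal is a lattice with $\mathcal{O}_r(I)=\mathcal{O}$; it is integral if $I\subset\mathcal{O}$. $\mathrm{nrd}(I)$ is the $\mathbb{Z}_K$-module generated by the reduced norms of elements of $I$. Subscript $\mathfrak{p}$ denotes $\mathfrak{p}$-adic completion, $v_{\mathfrak{p}}$ the $\mathfrak{p}$-adic valuation. Bruhat–Tits tree $\mathcal{T}_{\mathfrak{p}}$: fix $A\otimes_K K_{\mathfrak{p}}\cong M_2(K_{\mathfrak{p}})$. Let $R$ be the valuation ring of $K_{\mathfrak{p}}$ and $\pi$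 a uniformizer. Vertices are homothety classes of rank $2$ $R$-lattices in $K_{\mathfrak{p}}^2$; the distance between the classes of $L,L'$ is $|a-b|$ if $L$ has an $R$-basis $(e_1,e_2)$ with $(\pi^ae_1,\pi^be_2)$ an $R$-basis of $L'$; edges join vertices at distance $1$. This is a tree with an action of $\mathrm{GL}_2(K_{\mathfrak{p}})$, hence of $A^\times$; the segment $PQ$ is the unique shortest path between $P$ and $Q$. The fixed point of $\mathcal{O}'^\times$ for a maximal order $\mathcal{O}'$ is the vertex with stabilizer $K_{\mathfrak{p}}^\times\mathcal{O}_{\mathfrak{p}}'^\times$ in $(A\otimes_K K_{\mathfrak{p}})^\times$. A $\mathfrak{p}$-reduction structure: put $\mathcal{O}_0=\mathcal{O}$ and let $P_0$ be the fixed point of $\mathcal{O}_0^\times$ in $\mathcal{T}_{\mathfrak{p}}$; the data are (1) the left order $\mathcal{O}_1$ of an integral right $\mathcal{O}$-ideal of norm $\mathfrak{p}$, and the fixed point $P_1$ of $\mathcal{O}_1^\times$ in $\mathcal{T}_{\mathfrak{p}}$; (2) for each $b\in\{0,1\}$ and each vertex $P$ at distance $1$ from $P_b$, an element $g\in\mathcal{O}_b^\times$ with $g\cdot P=P_{1-b}$. LocalGenerator($I,\mathfrak{p}$) is a subroutine returning an element $x\in I$ such that $I_{\mathfrak{p}}=x\mathcal{O}_{\mathfrak{p}}$. Algorithm PReduce, on input $I$, $\mathfrak{p}$ and a $\mathfrak{p}$-reduction structure: 1. $r\leftarrow$ the largest integer such that $I\subset\mathcal{O}\mathfrak{p}^r$;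 $J\leftarrow I\mathfrak{p}^{-r}$. 2. $k\leftarrow v_{\mathfrak{p}}(\mathrm{nrd}(J))$; $c\leftarrow1$; $b\leftarrow0$. 3. $x\leftarrow$ LocalGenerator($I,\mathfrak{p}$); $Q\leftarrow x\cdot P_0$. 4. Repeat the following, testing the exit condition $k<2$ at the end of each pass, until $k<2$: let $P$ be the vertex at distance $1$ from $P_b$ in the segment $P_bQ$; replace $(c,J,Q)$ by $(gc,gJ,g\cdot Q)$, where $g\in\mathcal{O}_b^\times$ is the element of the structure with $g\cdot P=P_{1-b}$; if $b=1$, then $J\leftarrow J\mathfrak{p}^{-1}$, $r\leftarrow r+1$, $k\leftarrow k-2$; then $b\leftarrow1-b$. 5. Return $J,c,r$.
   Formalization: When k = 0 at the start, Q = P_0 and the segment P_0Q contains no vertex at distance 1 from P_0, so the first pass is undefined; here P may then be any vertex at distance 1 from P_0, and correctness is proved for every such choice. *)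

(* Defs.v *)
From mathcomp Require Import all_boot all_order all_algebra all_field.
From mathcomp Require Import boolp classical_sets reals.
From mathcomp Require Import complex.

Set Implicit Arguments.
Unset Strict Implicit.
Unset Printing Implicit Defensive.

Import Order.TTheory GRing.Theory Num.Theory.
Local Open Scope classical_set_scope.
Local Open Scope ring_scope.

(* The additive subgroup generated by the products [s *: x], [s] in [S] and
   [x] in [X]: the product of a fractional ideal and a lattice, the module
   generated by a set, and (with [V := K^o]) the product of two ideals. *)
Definition span_mul (F : fieldType) (V : lmodType F) (S : set F) (X : set V) :
    set V :=
  [set y | exists n (s : 'I_n -> F) (x : 'I_n -> V),
     [/\ forall i, S (s i), forall i, X (x i) & y = \sum_i s i *: x i]].

Section Arithmetic.
Variable K : fieldExtType rat.

Definition ringOfIntegers : set K := [set x | integralOver (intr : int -> K) x].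
Local Notation ZK := ringOfIntegers.

Definition ideal (a : set K) : Prop :=
  [/\ a `<=` ZK, a 0, forall x y, a x -> a y -> a (x + y)
    & forall s x, ZK s -> a x -> a (s * x)].

Definition prime_ideal (p : set K) : Prop :=
  [/\ ideal p, exists2 x, p x & x != 0, ~ p 1
    & forall x y, ZK x -> ZK y -> p (x * y) -> p x \/ p y].

Definition mul_ideal (a b : set K) : set K := @span_mul K K^o a b.

Definition inv_ideal (a : set K) : set K :=
  [set x | forall y, a y -> ZK (x * y)].

Definition pow_ideal (a : set K) (n : int) : set K :=
  match n with
  | Posz m => iter m (mul_ideal a) ZK
  | Negz m => inv_ideal (iter m.+1 (mul_ideal a) ZK)
  end.

(* [n] is the exponent of [p] in the factorization of the fractional ideal
   [a]: [a] is [p ^ n] times a quotient [b / c] of ideals prime to [p]. *)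
Definition val_ideal (p a : set K) (n : int) : Prop :=
  exists b c, [/\ ideal b, ideal c, ~ b `<=` p, ~ c `<=` p
    & mul_ideal a c = mul_ideal (pow_ideal p n) b].

Definition val_elt (p : set K) (x : K) (n : int) : Prop :=
  val_ideal p [set x * s | s in ZK] n.

(* The completion of [K] at [p], characterized up to isomorphism over [K]: a
   complete discretely valued field in which [K] is dense and whose valuation
   extends the [p]-adic one.  The value [cval 0] is irrelevant. *)
Record completion (p : set K) := Completion {
  cfield :> fieldType;
  cemb : {rmorphism K -> cfield};
  cval : cfield -> int;
  cunif : cfield;
  cvalM : forall x y, x != 0 -> y != 0 -> cval (x * y) = cval x + cval y;
  cvalD : forall x y, x != 0 -> y != 0 -> x + y != 0 ->
    Order.min (cval x) (cval y) <= cval (x + y);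
  cval_emb : forall x : K, x != 0 -> val_elt p x (cval (cemb x));
  cunif_neq0 : cunif != 0;
  cval_unif : cval cunif = 1;
  cdense : forall (z : cfield) (n : int),
    exists x : K, z - cemb x = 0 \/ n <= cval (z - cemb x);
  ccomplete : forall u : nat -> cfield,
    (forall N : int, exists n0 : nat, forall m n, (n0 <= m)%N -> (n0 <= n)%N ->
      u m - u n = 0 \/ N <= cval (u m - u n)) ->
    exists l, forall N : int, exists n0 : nat, forall n, (n0 <= n)%N ->
      u n - l = 0 \/ N <= cval (u n - l)
}.

Definition valuation_ring (p : set K) (Kp : completion p) : set Kp :=
  [set z | z = 0 \/ 0 <= cval z].

Section Algebra.
Variable A : falgType K.

Record quaternion_algebra := QuaternionAlgebra {
  qa : K;
  qb : K;
  qi : A;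
  qj : A;
  qa_neq0 : qa != 0;
  qb_neq0 : qb != 0;
  qi_sqr : qi * qi = qa%:A;
  qj_sqr : qj * qj = qb%:A;
  qji : qj * qi = - (qi * qj);
  qbasis : basis_of {:A} [tuple 1; qi; qj; qi * qj]
}.

Definition nrd (H : quaternion_algebra) (x : A) : K :=
  let B := [tuple 1; qi H; qj H; qi H * qj H] in
  let t := coord B (inord 0) x in let u := coord B (inord 1) x in
  let v := coord B (inord 2) x in let w := coord B (inord 3) x in
  t ^+ 2 - qa H * u ^+ 2 - qb H * v ^+ 2 + qa H * qb H * w ^+ 2.

(* For a field extension [iota : K -> L], a [K]-algebra morphism from [A] to
   the 2 x 2 matrices is the same as an [L]-algebra morphism from the tensor
   product of [A] and [L]; the latter is an isomorphism when a [K]-basis of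
   [A] is sent to an [L]-basis. *)
Definition splitting (L : fieldType) (iota : {rmorphism K -> L})
    (phi : {rmorphism A -> 'M[L]_2}) : Prop :=
  (forall a x, phi (a *: x) = iota a *: phi x)
  /\ basis_of {:'M[L]_2} [seq phi x | x <- vbasis {:A}].

Definition split_over (L : fieldType) (iota : {rmorphism K -> L}) : Prop :=
  exists phi, splitting iota phi.

Definition indefinite (R : realType) : Prop :=
  (exists iota : {rmorphism K -> R}, split_over iota)
  \/ (exists2 iota : {rmorphism K -> R[i]},
        exists x, complex.Im (iota x) != 0 & split_over iota).

Definition lattice (I : set A) : Prop :=
  (exists n (e : 'I_n -> A), I = span_mul ZK (range e))
  /\ span_mul setT I = setT.

Definition right_order (I : set A) : set A :=
  [set x | forall y, I y -> I (y * x)].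

Definition left_order (I : set A) : set A :=
  [set x | forall y, I y -> I (x * y)].

Definition order (O : set A) : Prop :=
  [/\ lattice O, O 1 & forall x y, O x -> O y -> O (x * y)].

Definition maximal_order (O : set A) : Prop :=
  order O /\ forall O', order O' -> O `<=` O' -> O' = O.

Definition order_units (O : set A) : set A :=
  [set u | [/\ u \is a GRing.unit, O u & O u^-1]].

Definition integral_right_ideal (O I : set A) : Prop :=
  [/\ lattice I, right_order I = O & I `<=` O].

Definition nrd_ideal (H : quaternion_algebra) (I : set A) : set K :=
  @span_mul K K^o ZK (nrd H @` I).

Definition lmul_set (g : A) (I : set A) : set A := [set g * x | x in I].

Section Local.
Variables (p : set K) (Kp : completion p) (phi : {rmorphism A -> 'M[Kp]_2}).
Local Notation R := (valuation_ring (Kp := Kp)).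
Local Notation pi := (cunif Kp).

(* The completion of a finitely generated module [I] is [I] tensored with
   [R], that is, the [R]-span of [I]. *)
Definition local_lattice (I : set A) : set 'M[Kp]_2 :=
  span_mul R (phi @` I).

Definition Rbasis (L : set 'cV[Kp]_2) (e1 e2 : 'cV[Kp]_2) : Prop :=
  free [:: e1; e2]
  /\ L = [set y | exists s t, [/\ R s, R t & y = s *: e1 + t *: e2]].

(* Vertices of the Bruhat-Tits tree are sets of lattices. *)
Definition vertex : Type := set (set 'cV[Kp]_2).

Definition is_vertex (P : vertex) : Prop :=
  exists L e1 e2, Rbasis L e1 e2
    /\ P = [set L' | exists2 c : Kp, c != 0 & L' = [set c *: y | y in L]].

Definition distance (P Q : vertex) (d : nat) : Prop :=
  exists L L' e1 e2 (a b : int),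
    [/\ P L, Q L', Rbasis L e1 e2, Rbasis L' (pi ^ a *: e1) (pi ^ b *: e2)
      & d = `|a - b|%N].

Definition walk (P Q : vertex) (n : nat) (v : nat -> vertex) : Prop :=
  [/\ v 0%N = P, v n = Q, forall i, (i <= n)%N -> is_vertex (v i)
    & forall i, (i < n)%N -> distance (v i) (v i.+1) 1].

Definition on_segment (P Q V : vertex) : Prop :=
  exists n v, [/\ walk P Q n v, forall m w, walk P Q m w -> (n <= m)%N
    & exists2 i, (i <= n)%N & V = v i].

Definition actM (m : 'M[Kp]_2) (P : vertex) : vertex :=
  [set [set m *m y | y in L] | L in P].

Definition act (g : A) (P : vertex) : vertex := actM (phi g) P.

Definition fixed_point (O : set A) (P : vertex) : Prop :=
  is_vertex P /\
  forall m : 'M[Kp]_2, m \in unitmx ->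
    (actM m P = P <->
     exists (c : Kp) (u : 'M[Kp]_2),
       [/\ c != 0, u \in unitmx, local_lattice O u,
           local_lattice O (invmx u) & m = c *: u]).

(* Index 0 is [false] and index 1 is [true]; [rsg b P] is only meaningful when
   [P] is a vertex at distance 1 from the vertex of index [b]. *)
Record reduction_structure (H : quaternion_algebra) (O : set A) :=
  ReductionStructure {
  rsO : bool -> set A;
  rsP : bool -> vertex;
  rsg : bool -> vertex -> A;
  rsO0 : rsO false = O;
  rsO1 : exists N, [/\ integral_right_ideal O N, nrd_ideal H N = p
                     & rsO true = left_order N];
  rsP_fixed : forall b, fixed_point (rsO b) (rsP b);
  rsg_units : forall b P, is_vertex P -> distance (rsP b) P 1 ->
    order_units (rsO b) (rsg b P);
  rsgP : forall b P, is_vertex P -> distance (rsP b) P 1 ->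
    act (rsg b P) P = rsP (~~ b)
}.

Definition local_generator (O : set A) (LG : set A -> A) : Prop :=
  forall I, integral_right_ideal O I ->
    I (LG I) /\ local_lattice I = [set phi (LG I) *m y | y in local_lattice O].

Record state := State {
  stJ : set A;
  stc : A;
  str : int;
  stk : int;
  stb : bool;
  stQ : vertex
}.

Section PReduce.
Variables (H : quaternion_algebra) (O : set A) (S : reduction_structure H O).
Variable LG : set A -> A.

Definition initial (I : set A) (s : state) : Prop :=
  exists r k : int,
    let J := span_mul (pow_ideal p (- r)) I in
    [/\ I `<=` span_mul (pow_ideal p r) O,
        forall r', I `<=` span_mul (pow_ideal p r') O -> r' <= r,
        val_ideal p (nrd_ideal H J) k
      & s = State J 1 r k false (act (LG I) (rsP S false))].

(* If [Q] is the current vertex itself (this happens only in the first pass,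
   when [k = 0]), the segment is reduced to a point and does not determine
   [P]: every neighbour of the current vertex is then allowed. *)
Definition selected (s : state) (P : vertex) : Prop :=
  [/\ is_vertex P, distance (rsP S (stb s)) P 1
    & stQ s <> rsP S (stb s) -> on_segment (rsP S (stb s)) (stQ s) P].

Definition update (s : state) (P : vertex) : state :=
  let g := rsg S (stb s) P in
  let J := lmul_set g (stJ s) in
  let Q := act g (stQ s) in
  if stb s
  then State (span_mul (pow_ideal p (-1)) J) (g * stc s) (str s + 1)
             (stk s - 2) false Q
  else State J (g * stc s) (str s) (stk s) true Q.

Definition pass (s s' : state) : Prop :=
  exists2 P, selected s P & s' = update s P.

(* Total correctness of the loop started in [s]: a pass can be executed, and
   after each possible pass either the loop exits in a state satisfying
   [Post], or it goes on and is again totally correct.  Being an inductive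
   predicate, it rules out infinite executions. *)
Inductive loop_correct (Post : state -> Prop) (s : state) : Prop :=
  LoopCorrect of
    (exists s', pass s s') &
    (forall s', pass s s' -> stk s' < 2 -> Post s') &
    (forall s', pass s s' -> ~~ (stk s' < 2) -> loop_correct Post s').

Definition PReduce_correct (Post : set A -> A -> int -> Prop) (I : set A) :
    Prop :=
  (exists s, initial I s)
  /\ forall s, initial I s ->
       loop_correct (fun s' => Post (stJ s') (stc s') (str s')) s.

End PReduce.
End Local.
End Algebra.
End Arithmetic.

(* Main.v *)
Require Import Defs.
From mathcomp Require Import all_boot all_order all_algebra all_field.
From mathcomp Require Import boolp classical_sets reals.
From mathcomp Require Import ring zify.

Set Implicit Arguments.
Unset Strict Implicit.
Unset Printing Implicit Defensive.

Import Order.TTheory GRing.Theory Num.Theory.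
Local Open Scope classical_set_scope.
Local Open Scope ring_scope.

(** The algorithm is a descent in the Bruhat-Tits tree. All the information that
    matters is local at [p]. If [E] is a basis of a lattice of the base vertex,
    the completion of [O] is the ring of integral matrices in the basis [E]
    ([fixed_point_local]). A right [O]-ideal [J] inside [O] has a local generator [x] at [p],
    and the matrix of [x] has a Smith normal form: it is primitive, that is not
    divisible by [p], exactly when [J] is not contained in [O p]. For a
    primitive [x] the distance from the base vertex to its image [Q] is the
    valuation of the determinant of [x] ([mindist_prim]), and since determinants
    are reduced norms ([det_phi]) this is the exponent [k] of [p] in the norm of [J]
    ([val_nrd_ideal]).

    Initially, the division of [I] by the largest possible power of [p] makes its
    generator primitive ([initial_content]). A pass with [b = 0] multiplies [J] by
    a unit of [O]: it changes neither the inclusion in [O] nor [k], but it carries the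
    first edge of the segment to [Q] to the edge between the two base vertices, so
    the distance from the second vertex to [Q] becomes [k - 1]. A pass with [b = 1]
    multiplies [J] by a unit [g] of the second order and carries the next edge to the
    same edge, reversed: the distance from the base vertex to [Q] is now [k - 2],
    whereas the norm still has exponent [k]. Hence the new generator is divisible by
    [p] exactly once, and dividing by [p] restores the situation with [k - 2] in
    place of [k] ([pass_even], [pass_odd], [selected_next]).

    The remaining point is global: after these multiplications [J] must be contained
    in [O] at the other primes too. An element [y] of the algebra lies in [O] as
    soon as it lies in the completion at [p] and a power of [p] multiplies it
    into [O] ([local_lattice_denom], [localization_descent]), and [p] multiplies the
    second order into [O] because that order is the left order of an ideal of norm
    [p] ([conductor_left_order]). The latter uses that reduced traces and norms of
    elements of an order are integral ([multiplier_trd_nrd]).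

    The arithmetic of the number field that is required (invertibility of powers
    of [p], existence and uniqueness of the exponent of an ideal) is
    derived from the factorization of principal ideals that comes with the
    completion ([val_elt_denom]) and from the maximality of [p] ([prime_maximal]).
*)

(** * Products of a set of scalars and a set of vectors *)

Section SpanMul.
Variables (F : fieldType) (V : lmodType F).
Implicit Types (S : set F) (X M : set V).

Lemma span_mul_gen S X s x : S s -> X x -> span_mul S X (s *: x).
Proof.
by move=> Ss Xx; exists 1%N, (fun=> s), (fun=> x); split=> //; rewrite big_ord1.
Qed.

Lemma span_mul_ind S X M : M 0 -> (forall x y, M x -> M y -> M (x + y)) ->
  (forall s x, S s -> X x -> M (s *: x)) -> span_mul S X `<=` M.
Proof.
move=> M0 MD MZ _ [n [s [x [Ss Xx ->]]]].
by apply: (big_ind M) => // i _; apply: MZ.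
Qed.

Lemma span_mul0 S X : span_mul S X 0.
Proof.
by exists 0%N, (fun=> 0), (fun=> 0); split=> [[]|[]|] //; rewrite big_ord0.
Qed.

Lemma span_mulD S X x y : span_mul S X x -> span_mul S X y ->
  span_mul S X (x + y).
Proof.
move=> [n [s [u [Ss Xu ->]]]] [m [t [w [St Xw ->]]]].
pose cat T (a : 'I_n -> T) (b : 'I_m -> T) i :=
  match split i with inl j => a j | inr j => b j end.
exists (n + m)%N, (cat _ s t), (cat _ u w); split=> [i|i|].
- by rewrite /cat; case: splitP => j _.
- by rewrite /cat; case: splitP => j _.
rewrite big_split_ord /=; congr (_ + _); apply: eq_bigr => i _.
  by rewrite /cat (unsplitK (inl i)).
by rewrite /cat (unsplitK (inr i)).
Qed.

Lemma span_mul_sum S X (T : finType) (s : T -> F) (x : T -> V) :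
  (forall i, S (s i)) -> (forall i, X (x i)) ->
  span_mul S X (\sum_i s i *: x i).
Proof.
move=> Ss Xx; apply: big_ind => [|u v|i _]; first exact: span_mul0.
  exact: span_mulD.
exact: span_mul_gen.
Qed.

Lemma span_mul_sub S S' X X' : S `<=` S' -> X `<=` X' ->
  span_mul S X `<=` span_mul S' X'.
Proof.
move=> sS sX; apply: span_mul_ind => [|x y|s x Ss Xx]; first exact: span_mul0.
  exact: span_mulD.
by apply: span_mul_gen; [apply: sS | apply: sX].
Qed.

Lemma span_mulZ S X a x : (forall s, S s -> S (a * s)) -> span_mul S X x ->
  span_mul S X (a *: x).
Proof.
move=> aS; move: x.
apply: (@span_mul_ind S X [set x | span_mul S X (a *: x)]) => [|x y|s x Ss Xx] /=.
- by rewrite scaler0; apply: span_mul0.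
- by rewrite scalerDr; apply: span_mulD.
- by rewrite scalerA; apply: span_mul_gen => //; apply: aS.
Qed.

(** When the scalars are closed under addition, each generator of a finite family
    needs to be used only once. *)
Lemma span_mul_range S n (e : 'I_n -> V) :
  S 0 -> (forall a b, S a -> S b -> S (a + b)) ->
  forall y, span_mul S (range e) y <->
    exists2 s : 'I_n -> F, (forall i, S (s i)) & y = \sum_i s i *: e i.
Proof.
move=> S0 SD y; split; last first.
  by move=> [s Ss ->]; apply: span_mul_sum => // i; exists i.
move: y; apply: span_mul_ind.
- by exists (fun=> 0) => //; rewrite big1 // => i _; rewrite scale0r.
- move=> _ _ [s Ss ->] [t St ->]; exists (fun i => s i + t i) => [i|].
    exact: SD.
  by rewrite -big_split; apply: eq_bigr => i _; rewrite scalerDl.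
move=> s _ Ss [j _ <-]; exists (fun i => if i == j then s else 0) => [i|].
  by case: ifP.
rewrite (bigD1 j) //= eqxx big1 ?addr0 // => i /negPf->.
by rewrite scale0r.
Qed.

End SpanMul.

(** * The valuation of a completion *)

Section Valuation.
Variables (K : fieldExtType rat) (p : set K) (Kp : completion p).
Implicit Types (x y z : Kp) (n m : int).
Local Notation v := (@cval K p Kp).

(** The value of [cval] at 0 carries no information, so zero is put in by hand;
    with it, [val_ge n] is the fractional ideal of exponent [n]. *)
Definition val_ge n z : Prop := z = 0 \/ n <= v z.

Lemma cval1 : v 1 = 0.
Proof.
have := @cvalM K p Kp 1 1 (oner_neq0 _) (oner_neq0 _).
by rewrite mulr1; lia.
Qed.

Lemma cvalV x : x != 0 -> v x^-1 = - v x.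
Proof.
move=> x0; have := @cvalM K p Kp x x^-1 x0.
by rewrite invr_eq0 divff // cval1 => /(_ x0); lia.
Qed.

Lemma cvalN1 : v (-1) = 0.
Proof.
have N0 : -1 != 0 :> Kp by rewrite oppr_eq0 oner_eq0.
by have := cvalM N0 N0; rewrite mulrNN mulr1 cval1; lia.
Qed.

Lemma cvalN x : v (- x) = v x.
Proof.
have [->|x0] := eqVneq x 0; first by rewrite oppr0.
by rewrite -mulN1r cvalM ?oppr_eq0 ?oner_eq0 // cvalN1 add0r.
Qed.

Lemma cvalXn x (n : nat) : x != 0 -> v (x ^+ n) = n%:Z * v x.
Proof.
move=> x0; elim: n => [|n IHn]; first by rewrite expr0 cval1 mul0r.
by rewrite exprS cvalM ?expf_neq0 // IHn; lia.
Qed.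

Lemma cvalXz x n : x != 0 -> v (x ^ n) = n * v x.
Proof.
move=> x0; case: n => n; first exact: cvalXn.
by rewrite -[_ ^ _]/(_ ^+ n.+1)^-1 cvalV ?expf_neq0 // cvalXn // NegzE mulNr.
Qed.

Lemma cval_unifX n : v (cunif Kp ^ n) = n.
Proof. by rewrite cvalXz ?cunif_neq0 // cval_unif mulr1. Qed.

Lemma cunifX_neq0 n : cunif Kp ^ n != 0.
Proof. by rewrite expfz_neq0 // cunif_neq0. Qed.

Lemma val_geW n m z : m <= n -> val_ge n z -> val_ge m z.
Proof. by move=> mn [->|nz]; [left | right; apply: le_trans nz]. Qed.

Lemma val_ge_unit n z : z != 0 -> val_ge n z -> n <= v z.
Proof. by move=> z0 [z0'|//]; rewrite z0' eqxx in z0. Qed.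

Lemma val_geD n x y : val_ge n x -> val_ge n y -> val_ge n (x + y).
Proof.
move=> [->|nx] [->|ny]; rewrite ?add0r ?addr0; try by [left|right].
have [->|x0] := eqVneq x 0; first by rewrite add0r; right.
have [->|y0] := eqVneq y 0; first by rewrite addr0; right.
have [->|xy0] := eqVneq (x + y) 0; first by left.
by right; apply: le_trans (cvalD x0 y0 xy0); rewrite le_min nx.
Qed.

Lemma val_geN n x : val_ge n x -> val_ge n (- x).
Proof. by move=> [->|nx]; [left; rewrite oppr0 | right; rewrite cvalN]. Qed.

Lemma val_geB n x y : val_ge n x -> val_ge n y -> val_ge n (x - y).
Proof. by move=> xn /val_geN; apply: val_geD. Qed.

Lemma val_geM n m x y : val_ge n x -> val_ge m y -> val_ge (n + m) (x * y).
Proof.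
move=> [->|nx] [->|ny]; rewrite ?mul0r ?mulr0; try by left.
have [->|x0] := eqVneq x 0; first by rewrite mul0r; left.
have [->|y0] := eqVneq y 0; first by rewrite mulr0; left.
by right; rewrite cvalM //; apply: lerD.
Qed.

Lemma val_ge_sum n (T : finType) (P : pred T) (f : T -> Kp) :
  (forall i, P i -> val_ge n (f i)) -> val_ge n (\sum_(i | P i) f i).
Proof. by move=> nf; apply: big_ind => //; [left | apply: val_geD]. Qed.

Lemma val_ge1 : val_ge 0 1. Proof. by right; rewrite cval1. Qed.

Lemma val_ge_fin (T : finType) (f : T -> Kp) :
  exists N : nat, forall i, val_ge (- N%:Z) (f i).
Proof.
exists (\sum_i `|v (f i)|)%N => i; right.
rewrite (bigD1 i) //=; set a := absz _; lia.
Qed.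

(** A negative valuation would make the valuations of the powers decrease below
    any bound. This replaces integral closedness for elements about which only
    boundedness is known. *)
Lemma val_ge0_pow x n : (forall k : nat, val_ge n (x ^+ k)) -> val_ge 0 x.
Proof.
move=> xn; have [->|x0] := eqVneq x 0; first by left.
right; have [//|vx] := leP 0 (v x).
have /val_ge_unit := xn `|n|.+1; rewrite expf_neq0 // cvalXn // => /(_ isT).
by nia.
Qed.

End Valuation.

(** * The ring of integers *)

Section Integers.
Variable K : fieldExtType rat.
Local Notation ZK := (@ringOfIntegers K).

Lemma ZK0 : ZK 0. Proof. exact: integral0. Qed.
Lemma ZK1 : ZK 1. Proof. exact: integral1. Qed.
Lemma ZKD x y : ZK x -> ZK y -> ZK (x + y). Proof. exact: integral_add. Qed.
Lemma ZKN x : ZK x -> ZK (- x). Proof. exact: integral_opp. Qed.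
Lemma ZKB x y : ZK x -> ZK y -> ZK (x - y). Proof. exact: integral_sub. Qed.
Lemma ZKM x y : ZK x -> ZK y -> ZK (x * y). Proof. exact: integral_mul. Qed.
Lemma ZKint (c : int) : ZK c%:~R. Proof. exact: integral_id. Qed.
Lemma ZKX x n : ZK x -> ZK (x ^+ n).
Proof.
by move=> Zx; elim: n => [|n IHn]; [apply: ZK1 | rewrite exprS; apply: ZKM].
Qed.

Lemma ZK_horner (q : {poly int}) x : ZK x -> ZK (map_poly intr q).[x].
Proof.
move=> Zx; elim/poly_ind: q => [|q c IHq].
  by rewrite rmorph0 horner0; apply: ZK0.
rewrite rmorphD rmorphM /= map_polyX map_polyC !hornerE.
by apply: ZKD; [apply: ZKM | apply: ZKint].
Qed.

Definition ZKmod (V : lmodType K) (M : set V) : Prop :=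
  [/\ M 0, forall x y, M x -> M y -> M (x + y) & forall s x, ZK s -> M x -> M (s *: x)].

Lemma span_ZKmod (V : lmodType K) (a : set K) (X : set V) :
  (forall s x, ZK s -> a x -> a (s * x)) -> ZKmod (span_mul a X).
Proof.
move=> Za; split; [exact: span_mul0 | exact: span_mulD | move=> s x Zs].
by apply: span_mulZ => t; apply: Za.
Qed.

Lemma span_ZK (V : lmodType K) (X : set V) : ZKmod (span_mul ZK X).
Proof. by apply: span_ZKmod => s x; apply: ZKM. Qed.

Lemma span_ZK_id (V : lmodType K) (M : set V) : ZKmod M -> span_mul ZK M = M.
Proof.
move=> [M0 MD MZ]; apply/seteqP; split; first exact: span_mul_ind.
by move=> x Mx; rewrite -[x]scale1r; apply: span_mul_gen => //; apply: ZK1.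
Qed.

Lemma idealP (a : set K) : ideal a <-> a `<=` ZK /\ @ZKmod K^o a.
Proof. by split=> [[aZ a0 aD aM]|[aZ [a0 aD aM]]]; split. Qed.

End Integers.

(** * Maximality of a nonzero prime *)

Section Prime.
Variables (K : fieldExtType rat) (p : set K) (p_prime : prime_ideal p).
Local Notation ZK := (@ringOfIntegers K).

Let p_ideal : ideal p. Proof. by case: p_prime. Qed.
Let pM x y : ZK x -> ZK y -> p (x * y) -> p x \/ p y.
Proof. by case: p_prime => _ _ _ H; exact: H. Qed.
Let p_neq1 : ~ p 1. Proof. by case: p_prime. Qed.
Let p0 : p 0. Proof. by case: p_ideal. Qed.
Let pD x y : p x -> p y -> p (x + y). Proof. by case: p_ideal => _ _ H _; exact: H. Qed.
Let pZ s x : ZK s -> p x -> p (s * x). Proof. by case: p_ideal => _ _ _ H; exact: H. Qed.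
Let pZr s x : ZK s -> p x -> p (x * s). Proof. by rewrite mulrC; apply: pZ. Qed.
Let pN x : p x -> p (- x).
Proof. by rewrite -mulN1r; apply: pZ; apply/ZKN/ZK1. Qed.

Lemma prime_sub : p `<=` ZK. Proof. by case: p_ideal. Qed.

(** In an equation of the nonzero element [y] of [p] over the integers, factors
    [X] can be removed until the constant coefficient is nonzero; it is then a
    multiple of [y]. *)
Lemma prime_int : exists2 n : int, n != 0 & p n%:~R.
Proof.
have [_ [y py y0] _ _] := p_prime; have Zy := prime_sub py.
have [q mon_q qy] := Zy; move: qy (monic_neq0 mon_q); clear mon_q.
elim/poly_ind: q => [|q c IHq]; first by rewrite eqxx.
rewrite rmorphD rmorphM /= map_polyX map_polyC /root !hornerE.
have [->|c0] := eqVneq c 0; last first.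
  move=> /eqP /(canRL (addKr _)); rewrite addr0 => cE _.
  by exists c => //; rewrite cE; apply/pN/pZ/py/ZK_horner.
rewrite rmorph0 !addr0 mulf_eq0 (negPf y0) orbF => qy qX.
by apply: IHq; rewrite // -size_poly_eq0; apply: contraNneq qX => /eqP;
  rewrite size_poly_eq0 => /eqP->; rewrite mul0r.
Qed.

(** Let [n] be the least positive integer in [p]. A common divisor [g] of [c] and
    [n] is not in [p], so the cofactor of [g] in [n] is, and minimality of [n]
    gives [g = 1]: conclude by a Bezout relation. *)
Lemma prime_int_inv (c : int) : ~ p c%:~R -> exists d : int, p (1 - c%:~R * d%:~R).
Proof.
move=> pc.
have /ex_minnP[n /andP[n0 /asboolP pn] n_min] :
    exists n : nat, (0 < n)%N && `[< p n%:Z%:~R >].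
  have [n n0 pn] := prime_int; exists `|n|%N; rewrite absz_gt0 n0; apply/asboolP.
  by case: n {n0} pn => n // /pN; rewrite NegzE mulrNz opprK.
have [u [w uw]] := Bezoutz c n%:Z; set g := gcdz c n in uw.
have /dvdzP[h nE] : (g %| n%:Z)%Z by apply: dvdz_gcdr.
have : p g%:~R \/ p h%:~R.
  by apply: pM; [apply: ZKint | apply: ZKint | rewrite -intrM mulrC -nE].
case=> [pg|ph].
  case: pc; have /dvdzP[k ->] : (g %| c)%Z by apply: dvdz_gcdl.
  by rewrite intrM; apply: pZ => //; apply: ZKint.
exists u; suff g1 : g = 1.
  have -> : 1 - c%:~R * u%:~R = w%:~R * n%:Z%:~R :> K.
    have g1K : g%:~R = 1 :> K by rewrite g1.
    by rewrite -[X in X - _]g1K -!intrM -intrB -uw; congr (_%:~R); ring.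
  by apply: pZ => //; apply: ZKint.
have h_gt0 : 0 < h.
  by have : 0 <= g by []; nia.
have : (n <= `|h|)%N.
  apply: n_min; rewrite absz_gt0 gt_eqF //=; apply/asboolP.
  by rewrite gtz0_abs.
by have : 0 <= g by []; nia.
Qed.

(** The ring of integers modulo [p] is integral over the integers modulo [p],
    which form a field by [prime_int_inv]: an integral equation of [x] modulo [p]
    whose constant coefficient is not in [p] exhibits an inverse of [x]. *)
Lemma prime_maximal x : ZK x -> ~ p x -> exists2 a, ZK a & p (1 - x * a).
Proof.
move=> Zx px; have [q mon_q /rootP qx] := Zx.
have {qx} : p (map_poly intr q).[x] by rewrite qx.
elim/poly_ind: q mon_q => [|q c IHq]; first by rewrite monicE lead_coef0 eq_sym oner_eq0.
have [->|q0] := eqVneq q 0.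
  rewrite mul0r add0r monicE lead_coefC => /eqP->.
  by rewrite rmorph1 hornerC => /p_neq1.
rewrite monicE lead_coefDl ?lead_coefMX; last first.
  rewrite size_mulX // size_polyC; case: eqP => // _.
  by rewrite ltnS lt0n size_poly_eq0.
move=> mon_q; rewrite rmorphD rmorphM /= map_polyX map_polyC !hornerE /= => pq.
have Zq := ZK_horner q Zx; set qx := horner _ _ in pq Zq.
have [pc|pc] := pselect (p c%:~R).
  have /(pM Zq Zx)[|//] : p (qx * x).
    by rewrite -[_ * _](addrK (c%:~R : K)); apply/pD/pN.
  exact: IHq.
have [d pd] := prime_int_inv pc; exists (- qx * d%:~R).
  by apply/ZKM/ZKint/ZKN.
have -> : 1 - x * (- qx * d%:~R) = 1 - c%:~R * d%:~R + (qx * x + c%:~R) * d%:~R by ring.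
by apply: pD => //; apply: pZr => //; apply: ZKint.
Qed.

End Prime.

(** * Powers of a prime and valuations *)

Section PrimePowers.
Variables (K : fieldExtType rat) (p : set K) (p_prime : prime_ideal p).
Variable (Kp : completion p).
Local Notation ZK := (@ringOfIntegers K).
Local Notation vge n x := (@val_ge K p Kp n (cemb Kp x)).
Local Notation v x := (@cval K p Kp (cemb Kp x)).
Local Notation pow n := (pow_ideal p n).

Let emb_neq0 (x : K) : (cemb Kp x != 0) = (x != 0). Proof. by rewrite fmorph_eq0. Qed.

Lemma vK_D n (x y : K) : vge n x -> vge n y -> vge n (x + y).
Proof. by rewrite rmorphD; apply: val_geD. Qed.

Lemma vK_M n m (x y : K) : vge n x -> vge m y -> vge (n + m) (x * y).
Proof. by rewrite rmorphM; apply: val_geM. Qed.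

Lemma vK_eqM (x y : K) : x != 0 -> y != 0 -> v (x * y) = v x + v y.
Proof. by move=> x0 y0; rewrite rmorphM cvalM ?emb_neq0. Qed.

Lemma vge_v n (x : K) : x != 0 -> vge n x -> n <= v x.
Proof. by rewrite -emb_neq0; apply: val_ge_unit. Qed.

Lemma vge_int (c : int) : vge 0 c%:~R.
Proof.
have vnat (n : nat) : vge 0 n%:R.
  elim: n => [|n IHn]; first by left; rewrite rmorph0.
  by rewrite -addn1 natrD; apply: vK_D => //; rewrite rmorph1; apply: val_ge1.
by case: c => n; [|rewrite NegzE mulrNz rmorphN; apply: val_geN]; apply: vnat.
Qed.

(** The valuation ring is integrally closed, because a valuation is nonnegative
    on the integers. *)
Lemma vge_ZK x : ZK x -> vge 0 x.
Proof.
move=> [q mon_q qx]; have [vx|vx] := leP 0 (v x); first by right.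
have [->|x0] := eqVneq x 0; first by left; rewrite rmorph0.
have q_gt1 : (1 < size q)%N.
  rewrite ltnNge; apply: contraL qx => q1.
  have /eqP q1' : size q == 1%N by rewrite eqn_leq q1 lt0n size_poly_eq0 monic_neq0.
  have := mon_q; rewrite monicE lead_coefE q1' => /eqP q0.
  by rewrite (size1_polyC q1) q0 rmorph1 rootE hornerC oner_eq0.
have sE : size q = (size q).-2.+2 by case: (size q) q_gt1 => [|[]].
set d := (size q).-2 in sE.
(* The equation of [x], divided by a power of [x] that isolates [x]: the other
   terms are integral. *)
have xE : x = - \sum_(i < d.+1) (q`_i)%:~R * x ^- (d - i).
  move/rootP: qx; rewrite horner_coef (size_map_poly_id0 _) ?sE; last first.
    by rewrite (monicP mon_q) oner_eq0.
  rewrite big_ord_recr /= coef_map /=.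
  have -> : q`_d.+1 = 1 by move/monicP: mon_q; rewrite lead_coefE sE.
  rewrite mul1r => /(canRL (addKr _)); rewrite addr0 => xd.
  apply: (mulIf (expf_neq0 d x0)); rewrite -exprS xd mulNr mulr_suml.
  congr (- _); apply: eq_bigr => i _; rewrite coef_map /= -mulrA; congr (_ * _).
  have -> : x ^+ d = x ^+ (d - i) * x ^+ i by rewrite -exprD subnK // -ltnS.
  by rewrite mulKf // expf_neq0.
rewrite xE rmorphN rmorph_sum; apply/val_geN/val_ge_sum => i _.
rewrite -[0]addr0; apply: vK_M; first exact: vge_int.
rewrite fmorphV rmorphXn; right.
rewrite cvalV ?expf_neq0 ?emb_neq0 // cvalXn ?emb_neq0 // oppr_ge0.
by rewrite mulr_ge0_le0 // ltW.
Qed.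

Lemma pow_ZKmod n : @ZKmod K K^o (pow n).
Proof.
case: n => [[|m]|m].
- by split; [apply: ZK0 | apply: ZKD | move=> s x; apply: ZKM].
- by apply: span_ZKmod => s x; case: p_prime => -[_ _ _ pZ] _ _ _; apply: pZ.
split=> [y _|x y Zx Zy z z_|s x Zs Zx z z_]; first by rewrite mul0r; apply: ZK0.
  by rewrite mulrDl; apply: ZKD; [apply: Zx | apply: Zy].
by rewrite -mulrA; apply: ZKM => //; apply: Zx.
Qed.

Let powD n x y : pow n x -> pow n y -> pow n (x + y).
Proof. by case: (pow_ZKmod n) => _ D _; exact: D. Qed.
Let powZ n s x : ZK s -> pow n x -> pow n (s * x).
Proof. by case: (pow_ZKmod n) => _ _ Z; exact: Z. Qed.

Lemma pow_ZK (m : nat) : pow m `<=` ZK.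
Proof.
elim: m => // m IHm; apply: (@span_mul_ind K K^o) => [|x y|s x ps mx].
- exact: ZK0.
- exact: ZKD.
by apply: ZKM; [apply: prime_sub ps | apply: IHm].
Qed.

Lemma pow_M (m n : nat) x y : pow m x -> pow n y -> pow (m + n)%N (x * y).
Proof.
move=> mx ny; elim: m x mx => [x Zx|m IHm].
  by apply: (@powZ n x y).
apply: (@span_mul_ind K K^o _ _ [set x | pow (m.+1 + n)%N (x * y)]) => /=.
- by rewrite mul0r; case: (pow_ZKmod (m.+1 + n)%N).
- by move=> a b Ha Hb; rewrite mulrDl; exact: (@powD (m.+1 + n)%N).
move=> s x ps mx; rewrite -mulrA; apply: (@span_mul_gen K K^o) => //.
exact: IHm.
Qed.

Lemma prime_pow1 x : p x -> pow 1 x.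
Proof.
by move=> px; rewrite -[x]mulr1; apply: (@span_mul_gen K K^o) => //; apply: ZK1.
Qed.

Lemma pow_X (m : nat) x : p x -> pow m (x ^+ m).
Proof.
move=> px; elim: m => [|m IHm]; first by rewrite expr0; apply: ZK1.
by rewrite exprS; apply: (@span_mul_gen K K^o).
Qed.

Lemma pow_sub_prime (m : nat) : pow m.+1 `<=` p.
Proof.
have [[_ p0 pD pZ] _ _ _] := p_prime.
apply: (@span_mul_ind K K^o) => // s x ps /pow_ZK Zx.
by rewrite /GRing.scale /= mulrC; apply: pZ.
Qed.

Lemma pow1E : pow 1 = p.
Proof. by apply/seteqP; split=> x; [apply: pow_sub_prime | apply: prime_pow1]. Qed.

Lemma powN_mem (m : nat) x : pow (- m%:Z) x <-> forall y, pow m y -> ZK (x * y).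
Proof.
case: m => [|m]; last by rewrite -NegzE.
split=> [Zx y|/(_ 1 (@ZK1 K))]; last by rewrite mulr1.
exact: ZKM.
Qed.

Lemma pow_mono (m n : nat) : (m <= n)%N -> pow n `<=` pow m.
Proof.
move=> /subnK <-; elim: (n - m)%N => // k IHk; rewrite addSn.
apply: (@span_mul_ind K K^o) => [|x y|s x /(prime_sub p_prime) Zs /IHk mx].
- by case: (pow_ZKmod m).
- exact: powD.
exact: powZ.
Qed.

(** The principal ideal of [x] is [p ^ v x] times a quotient of ideals that are
    not contained in [p]; multiply [x] by an element of the denominator that is
    not in [p]. This is the main link between valuations and ideals. *)
Lemma val_elt_denom x : x != 0 -> exists s, [/\ ZK s, ~ p s & pow (v x) (s * x)].
Proof.
move=> x0; have [b [c [[bZ _ _ _] [cZ _ _ _] _ /existsNP[s /not_implyP[cs ps]] bc]]] :=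
  cval_emb Kp x0.
exists s; split=> //; first exact: cZ.
have : mul_ideal [set x * s | s in ZK] c (x * s).
  apply: (@span_mul_gen K K^o) => //; exists 1; first exact: ZK1.
  by rewrite mulr1.
rewrite bc mulrC; have [pow0 _ _] := pow_ZKmod (v x).
move: (s * x); apply: (@span_mul_ind K K^o) => // [y z|t y ty /bZ Zy]; first exact: powD.
by rewrite /GRing.scale /= mulrC; apply: powZ.
Qed.

(** If the valuation were 0, the ideal prime to [p] in the numerator of the
    factorization of [x] would be contained in [p]. *)
Lemma vge_prime x : p x -> vge 1 x.
Proof.
move=> px; have [->|x0] := eqVneq x 0; first by left; rewrite rmorph0.
have /(vge_v x0) := vge_ZK (prime_sub p_prime px).
rewrite le_eqVlt => /predU1P[vx|]; last by right; lia.
have [b [c [b_id [cZ _ _ _] /existsNP[z /not_implyP[bz pz]] _ bc]]] :=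
  cval_emb Kp x0.
have [[_ p0 pD pZ] _ _ _] := p_prime.
case: pz; have : mul_ideal (pow (v x)) b z.
  rewrite -vx -[z]mul1r; apply: (@span_mul_gen K K^o) => //; exact: ZK1.
rewrite -bc; move: z {bz}; apply: (@span_mul_ind K K^o) => // s y [t Zt <-] /cZ Zy.
by rewrite /GRing.scale /= -mulrA mulrC; apply: pZ => //; apply: ZKM.
Qed.

Lemma v_notp s : ZK s -> ~ p s -> v s = 0.
Proof.
move=> Zs ps; have [s0|s0] := eqVneq s 0.
  by case: ps; rewrite s0; case: p_prime => -[].
have /(vge_v s0) := vge_ZK Zs.
have [a [Za pa]] := val_elt_denom s0; case: (v s) => // -[//|n] pas.
have [_ _ _ pM] := p_prime.
by case: (pM a s Za Zs) => //; apply: pow_sub_prime pas.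
Qed.

Lemma vge0_denom x : vge 0 x -> exists s, [/\ ZK s, ~ p s & ZK (s * x)].
Proof.
move=> vx; have [->|x0] := eqVneq x 0.
  exists 1; split; rewrite ?mulr0; [exact: ZK1 | by case: p_prime | exact: ZK0].
have [s [Zs ps sx]] := val_elt_denom x0; exists s; split=> //.
by move: (vge_v x0 vx) sx; case: (v x) => // n _; apply: pow_ZK.
Qed.

(** Approximate the uniformizer of the completion by an element of the field, then
    clear its denominator, which is prime to [p]. *)
Lemma exists_unif : exists t, [/\ p t, t != 0 & v t = 1].
Proof.
have [x x2] := @cdense K p Kp (cunif Kp) 2.
have vpi : val_ge 1 (cunif Kp) by right; rewrite cval_unif.
have xE : cemb Kp x = cunif Kp - (cunif Kp - cemb Kp x) by ring.
have x1 : vge 1 x by rewrite xE; apply: val_geB => //; apply: val_geW x2.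
have x_lt2 : ~ vge 2 x.
  move=> /(val_geD x2); rewrite subrK => /val_ge_unit.
  by rewrite cunif_neq0 cval_unif => /(_ isT).
have x0 : x != 0 by apply/eqP => x0; apply: x_lt2; rewrite x0; left; rewrite rmorph0.
have vx : v x = 1.
  have := vge_v x0 x1; have [//|] := leP 2 (v x); last lia.
  by move=> ?; case: x_lt2; right.
have [s [Zs ps sx]] := val_elt_denom x0; move: sx; rewrite vx pow1E => sx.
have s0 : s != 0 by apply/eqP => s0; apply: ps; rewrite s0; case: p_prime => -[].
by exists (s * x); rewrite mulf_neq0 // vK_eqM // vx v_notp.
Qed.

(** For negative [n] the power is defined as an inverse ideal, and an element of
    exact valuation comes from clearing the denominator of a power of a
    uniformizer with [val_elt_denom]. *)
Lemma pow_elt n : exists x, [/\ pow n x, x != 0 & v x = n].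
Proof.
have [t [pt t0 vt]] := exists_unif.
have vtn : v (t ^ n) = n by rewrite fmorphXz cvalXz ?emb_neq0 // vt mulr1.
case: n vtn => n vtn; first by exists (t ^+ n); rewrite expf_neq0 //; split=> //; apply: pow_X.
have tn0 : t ^ (Negz n) != 0 by rewrite expfz_neq0.
have [s [Zs ps sx]] := val_elt_denom tn0.
have s0 : s != 0 by apply/eqP => s0; apply: ps; rewrite s0; case: p_prime => -[].
exists (s * t ^ Negz n); split; first by move: sx; rewrite vtn.
  by rewrite mulf_neq0.
by rewrite vK_eqM // vtn v_notp // add0r.
Qed.

Lemma vge_pow n x : pow n x -> vge n x.
Proof.
case: n => n.
  elim: n x => [|n IHn]; first exact: vge_ZK.
  apply: (@span_mul_ind K K^o p _ [set x | vge n.+1 x]) => [|x y|s x ps /IHn nx] /=.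
  - by left; rewrite rmorph0.
  - exact: vK_D.
  by rewrite -add1n PoszD; apply: vK_M => //; apply: vge_prime.
have [y [ny y0 vy]] := pow_elt n.+1; move=> /(_ y ny) /vge_ZK xy.
have [->|x0] := eqVneq x 0; first by left; rewrite rmorph0.
by right; have := vge_v (mulf_neq0 x0 y0) xy; rewrite vK_eqM // vy NegzE; lia.
Qed.

(** The maximality of [p] is the case [m = 1]; multiply such relations together. *)
Lemma pow_coprime (m : nat) s : ZK s -> ~ p s ->
  exists a q, [/\ ZK a, pow m q & 1 = s * a + q].
Proof.
move=> Zs ps; have [a Za pa] := prime_maximal p_prime Zs ps.
elim: m => [|m [b [q [Zb mq E]]]].
  by exists 0, 1; split; [apply: ZK0 | apply: ZK1 | rewrite mulr0 add0r].
exists (b + a * q), ((1 - s * a) * q); split.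
- by apply: ZKD => //; apply: ZKM => //; apply: pow_ZK mq.
- exact: (@span_mul_gen K K^o).
by rewrite [LHS]E; ring.
Qed.

(** Powers of [p] are invertible: the product of [p ^ m] and its inverse contains
    [p ^ m] and an element not in [p]. The relation is given explicitly because
    its coefficients [b] will generate [p ^ -m]. *)
Lemma pow_mulN (m : nat) :
  exists n (a b : 'I_n -> K),
    [/\ forall i, pow m (a i), forall i, pow (- m%:Z) (b i) & 1 = \sum_i a i * b i].
Proof.
have [t [mt t0 vt]] := pow_elt m; have [w [mw w0 vw]] := pow_elt (- m%:Z).
have Zwt : ZK (w * t) by move/powN_mem: mw => /(_ t mt).
have ptw : ~ p (w * t).
  by move/vge_prime/(vge_v (mulf_neq0 w0 t0)); rewrite vK_eqM // vw vt addNr.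
have [a [q [Za mq E]]] := pow_coprime m Zwt ptw.
have P1 : pow (- m%:Z) 1 by apply/powN_mem => y /pow_ZK; rewrite mul1r.
exists 2%N, (fun i => if i == 0 then a * t else q), (fun i => if i == 0 then w else 1).
split=> [i|i|]; try by case: ifP => // _; apply: powZ.
by rewrite [LHS]E !big_ord_recl big_ord0 /=; ring.
Qed.

(** [val_elt_denom] puts a multiple of [x] by an element prime to [p] into the
    power, and [pow_coprime] removes this factor. *)
Lemma pow_vge (m : nat) x : ZK x -> vge m x -> pow m x.
Proof.
move=> Zx mx; have [->|x0] := eqVneq x 0; first by case: (pow_ZKmod m).
have [s [Zs ps sx]] := val_elt_denom x0.
have msx : pow m (s * x).
  have := vge_v x0 mx; move: sx; case: (v x) => // n nsx mn.
  by apply: pow_mono nsx; lia.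
have [a [q [Za mq E]]] := pow_coprime m Zs ps.
rewrite -[x]mul1r E mulrDl; apply: powD; last by rewrite mulrC; apply: powZ.
by rewrite mulrAC mulrC; apply: powZ.
Qed.

(** The ideal [p ^ -m a] is integral because [a] lies in [p ^ m] by [pow_vge], and
    it is not contained in [p] because it has an element of valuation 0: this is
    the factorization that the definition of the exponent asks for. *)
Lemma val_ideal_min (a : set K) y (m : nat) : ideal a -> a y -> y != 0 -> v y = m ->
  (forall x, a x -> vge m x) -> val_ideal p a m.
Proof.
move=> /[dup] a_id /idealP[aZ a_mod] ay y0 vy am; have [a0 aD aZs] := a_mod.
have pa x w : a x -> pow (- m%:Z) w -> ZK (w * x).
  by move=> ax /powN_mem; apply; apply: pow_vge; [apply: aZ | apply: am].
exists (mul_ideal (pow (- m%:Z)) a), ZK; split.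
- apply/idealP; split; last by apply: span_ZKmod => s x; apply: powZ.
  apply: (@span_mul_ind K K^o) => [|u w|w x mw ax]; [exact: ZK0 | exact: ZKD | exact: pa].
- apply/idealP; split=> //; split; [apply: ZK0 | apply: ZKD | move=> s x; apply: ZKM].
- have [w [mw w0 vw]] := pow_elt (- m%:Z) => /(_ (w * y)) wyp.
  have /vge_prime/(vge_v (mulf_neq0 w0 y0)) : p (w * y).
    by apply: wyp; apply: (@span_mul_gen K K^o).
  by rewrite vK_eqM // vw vy addNr.
- by case: p_prime => _ _ p1 _ /(_ 1 (@ZK1 K)).
apply/seteqP; split.
  have [n [b [c [mb mc E]]]] := pow_mulN m.
  apply: (@span_mul_ind K K^o) => [|u w|x s ax Zs]; [exact: span_mul0 | exact: span_mulD|].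
  rewrite /GRing.scale /= -[_ * _]mul1r E mulr_suml.
  under eq_bigr do rewrite -mulrA.
  apply: (@span_mul_sum K K^o _ _ _ b (fun i => c i * (x * s))) => // i.
  by apply: (@span_mul_gen K K^o) => //; rewrite mulrC; apply: aZs.
apply: (@span_mul_ind K K^o) => [|u w|t x mt]; [exact: span_mul0 | exact: span_mulD|].
rewrite /GRing.scale /=.
suff ax : mul_ideal (pow (- m%:Z)) a x -> a (t * x).
  move=> /ax atx; rewrite -[_ * _]mulr1.
  by apply: (@span_mul_gen K K^o) => //; apply: ZK1.
move: x; apply: (@span_mul_ind K K^o _ _ [set x | a (t * x)]) => [|u w|w x mw ax] /=.
- by rewrite mulr0.
- by move=> au aw; rewrite mulrDr; apply: aD.
by rewrite mulrA; apply: (aZs) => //; rewrite mulrC; move/powN_mem: mw; apply.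
Qed.

(** In [a c = p ^ k b] compare the least valuations on both sides, using that [b]
    and [c] have elements of valuation 0. *)
Lemma val_ideal_unique (a : set K) y (m k : int) : a y -> y != 0 -> v y = m ->
  (forall x, a x -> vge m x) -> val_ideal p a k -> k = m.
Proof.
move=> ay y0 vy am [b [c [[bZ _ _ _] [cZ _ _ _] /existsNP[z /not_implyP[bz pz]]
  /existsNP[s /not_implyP[cs ps]] bc]]].
have notp0 u : ~ p u -> u != 0.
  by move=> pu; apply/eqP => u0; apply: pu; rewrite u0; case: p_prime => -[].
apply/eqP; rewrite eq_le; apply/andP; split.
  have : mul_ideal a c (y * s) by apply: (@span_mul_gen K K^o).
  rewrite bc => kys.
  have : vge k (y * s).
    move: kys; move: (y * s); apply: (@span_mul_ind K K^o _ _ [set x | vge k x]) => [|u w|u w] /=.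
    - by left; rewrite rmorph0.
    - exact: vK_D.
    by move=> /vge_pow ku /bZ/vge_ZK w0; rewrite -[k]addr0; apply: vK_M.
  move/(vge_v (mulf_neq0 y0 (notp0 _ ps))).
  by rewrite vK_eqM ?(notp0 _ ps) // vy (v_notp (cZ _ cs) ps) addr0.
have [t [kt t0 vt]] := pow_elt k.
have : mul_ideal (pow k) b (t * z) by apply: (@span_mul_gen K K^o).
rewrite -bc => mtz.
have : vge m (t * z).
  move: mtz; move: (t * z); apply: (@span_mul_ind K K^o _ _ [set x | vge m x]) => [|u w|u w] /=.
  - by left; rewrite rmorph0.
  - exact: vK_D.
  by move=> /am mu /cZ/vge_ZK w0; rewrite -[m]addr0; apply: vK_M.
move/(vge_v (mulf_neq0 t0 (notp0 _ pz))).
by rewrite vK_eqM ?(notp0 _ pz) // vt (v_notp (bZ _ bz) pz) addr0.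
Qed.

End PrimePowers.

(** * Two by two matrices *)

Section Matrix22.
Variable L : fieldType.

Lemma det22 (Z : 'M[L]_2) : \det Z = Z 0 0 * Z 1 1 - Z 0 1 * Z 1 0.
Proof.
rewrite (expand_det_row _ 0) !big_ord_recl big_ord0 addr0 /cofactor !det_mx11 !mxE.
rewrite expr0 mul1r expr1 mulN1r mulrN.
by congr (Z _ _ * Z _ _ - Z _ _ * Z _ _); apply: val_inj.
Qed.

Lemma mulmx22 (Y Z : 'M[L]_2) i j : (Y *m Z) i j = Y i 0 * Z 0 j + Y i 1 * Z 1 j.
Proof.
rewrite mxE !big_ord_recl big_ord0 addr0.
by congr (_ + Y _ _ * Z _ _); apply: val_inj.
Qed.

Lemma ord2 (k : 'I_2) : k = 0 \/ k = 1.
Proof. by case: k => [[|[|]]] // ?; [left | right]; apply: val_inj. Qed.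

Lemma matrix22P (Y Z : 'M[L]_2) : Y 0 0 = Z 0 0 -> Y 0 1 = Z 0 1 ->
  Y 1 0 = Z 1 0 -> Y 1 1 = Z 1 1 -> Y = Z.
Proof.
move=> E00 E01 E10 E11; apply/matrixP => i j.
by have [->|->] := ord2 i; have [->|->] := ord2 j.
Qed.

End Matrix22.

(** * Lattices, vertices and walks in the tree *)

Section Tree.
Variables (K : fieldExtType rat) (p : set K) (Kp : completion p).
Local Notation v := (@cval K p Kp).
Local Notation pi := (cunif Kp).
Local Notation vge := (@val_ge K p Kp).

Implicit Types (P Q V : vertex Kp).

Definition integral_mx m n (Z : 'M[Kp]_(m, n)) : Prop := forall i j, vge 0 (Z i j).

(** GL_2 of the valuation ring; a unit determinant is easier to check than an
    integral inverse. *)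
Definition integral_GL (U : 'M[Kp]_2) : Prop := [/\ integral_mx U, \det U != 0 & v (\det U) = 0].

Lemma integral_mx_mul m n k (Y : 'M_(m, n)) (Z : 'M_(n, k)) :
  integral_mx Y -> integral_mx Z -> integral_mx (Y *m Z).
Proof.
move=> Yi Zi i j; rewrite mxE; apply: val_ge_sum => l _.
by rewrite -[0]addr0; apply: val_geM.
Qed.

Lemma integral_mx_scale m n c (Z : 'M_(m, n)) : vge 0 c -> integral_mx Z -> integral_mx (c *: Z).
Proof. by move=> ci Zi i j; rewrite mxE -[0]addr0; apply: val_geM. Qed.

Lemma integral_mx_add m n (Y Z : 'M_(m, n)) : integral_mx Y -> integral_mx Z -> integral_mx (Y + Z).
Proof. by move=> Yi Zi i j; rewrite mxE; apply: val_geD. Qed.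

Lemma integral_mx_delta m n (i : 'I_m) (j : 'I_n) : integral_mx (delta_mx i j).
Proof. by move=> k l; rewrite mxE; case: (_ && _); [apply: val_ge1 | left]. Qed.

Lemma integral_mx_scalar c : vge 0 c -> integral_mx (c%:M : 'M_2).
Proof. by move=> ci i j; rewrite mxE; case: (_ == _); [|left]. Qed.

Lemma integral_mx1 : integral_mx (1%:M : 'M_2).
Proof. exact/integral_mx_scalar/val_ge1. Qed.

Lemma vge_det n m (Z : 'M[Kp]_2) : (forall i j, vge n (Z i j)) -> m <= n + n ->
  vge m (\det Z).
Proof.
move=> Zi mn; rewrite det22.
by apply: val_geB; apply: val_geW (val_geM (Zi _ _) (Zi _ _)).
Qed.

Lemma integral_mx_det (Z : 'M[Kp]_2) : integral_mx Z -> vge 0 (\det Z).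
Proof. by move/vge_det; apply. Qed.

Lemma integral_mx_adj (Z : 'M[Kp]_2) : integral_mx Z -> integral_mx (\adj Z).
Proof.
move=> Zi i j; rewrite mxE /cofactor det_mx11 mxE [X in _ * X]mxE.
by rewrite -signr_odd mulr_sign; case: ifP => _; [apply: val_geN|]; apply: Zi.
Qed.

Lemma integral_GL_unit U : integral_GL U -> U \in unitmx.
Proof. by case=> _ detU _; rewrite unitmxE unitfE. Qed.

Lemma integral_GL1 : integral_GL 1%:M.
Proof. by rewrite /integral_GL det1 oner_neq0 cval1; split=> //; apply: integral_mx1. Qed.

Lemma integral_GL_mul U W : integral_GL U -> integral_GL W -> integral_GL (U *m W).
Proof.
move=> [Ui U0 vU] [Wi W0 vW]; split; first exact: integral_mx_mul.
  by rewrite det_mulmx mulf_neq0.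
by rewrite det_mulmx cvalM // vU vW.
Qed.

Lemma integral_GL_inv U : integral_GL U -> integral_GL (invmx U).
Proof.
move=> /[dup] /integral_GL_unit Uu [Ui U0 vU]; split.
- rewrite /invmx Uu; apply: integral_mx_scale; last exact: integral_mx_adj.
  by right; rewrite cvalV // vU oppr0.
- by rewrite det_inv invr_eq0.
- by rewrite det_inv cvalV // vU oppr0.
Qed.

Definition col_lattice (M : 'M[Kp]_2) : set 'cV[Kp]_2 := [set M *m z | z in @integral_mx 2 1].

Definition vertex_of (M : 'M[Kp]_2) : vertex Kp :=
  [set col_lattice (c *: M) | c in [set c | c != 0]].

Lemma col_latticeM (M U : 'M_2) : integral_GL U -> col_lattice (M *m U) = col_lattice M.
Proof.
move=> GU; apply/seteqP; split=> _ [z zi <-].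
  by exists (U *m z); rewrite ?mulmxA //; apply: integral_mx_mul zi; case: GU.
exists (invmx U *m z); first by apply: integral_mx_mul zi; case: (integral_GL_inv GU).
by rewrite -mulmxA mulKVmx // integral_GL_unit.
Qed.

Lemma col_lattice_sub (M N : 'M_2) : M \in unitmx -> col_lattice N `<=` col_lattice M ->
  exists2 U, integral_mx U & N = M *m U.
Proof.
move=> Mu NM; exists (invmx M *m N); last by rewrite mulKVmx.
move=> i j; have [|z zi Ez] := NM (N *m delta_mx j 0).
  by exists (delta_mx j 0) => //; apply: integral_mx_delta.
suff -> : (invmx M *m N) i j = z i 0 by [].
have -> : z = invmx M *m (N *m delta_mx j 0) by rewrite -Ez mulKmx.
by rewrite mulmxA -colE [RHS]mxE.
Qed.

Lemma col_lattice_eq (M N : 'M_2) : M \in unitmx -> N \in unitmx -> col_lattice M = col_lattice N ->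
  exists2 U, integral_GL U & N = M *m U.
Proof.
move=> Mu Nu MN.
have [|U Ui NE] := @col_lattice_sub M N Mu; first by rewrite MN.
have [|W Wi ME] := @col_lattice_sub N M Nu; first by rewrite MN.
exists U => //; have /(congr1 determinant) : U *m W = 1%:M.
  by apply: (can_inj (mulKmx Mu)); rewrite mulmxA -NE -ME mulmx1.
rewrite det_mulmx det1 => UW.
have U0 : \det U != 0 by apply: contra_eq_neq UW => ->; rewrite mul0r eq_sym oner_eq0.
have W0 : \det W != 0 by apply: contra_eq_neq UW => ->; rewrite mulr0 eq_sym oner_eq0.
split=> //; have := val_ge_unit U0 (integral_mx_det Ui).
have := val_ge_unit W0 (integral_mx_det Wi).
have := congr1 v UW; rewrite cvalM // cval1.
by set a := v _; set b := v (\det W); lia.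
Qed.

Lemma vertex_of_scale (c : Kp) M : c != 0 -> vertex_of (c *: M) = vertex_of M.
Proof.
move=> c0; apply/seteqP; split=> _ [d /= d0 <-].
  by exists (d * c); rewrite ?scalerA //= mulf_neq0.
by exists (d / c); rewrite ?scalerA ?divfK //= mulf_neq0 // invr_eq0.
Qed.

(** Together with [vertex_of_scale] and [vertex_of_eq] this identifies the
    vertices with the cosets of invertible matrices modulo scalars and integral
    invertible matrices, so that walks become products of matrices. *)
Lemma vertex_ofM M U : integral_GL U -> vertex_of (M *m U) = vertex_of M.
Proof.
by move=> GU; apply/seteqP; split=> _ [d /= d0 <-]; exists d => //;
  rewrite scalemxAl col_latticeM.
Qed.

Lemma mem_vertex_of M : vertex_of M (col_lattice M).
Proof. by exists 1; rewrite /= ?oner_neq0 // scale1r. Qed.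

Lemma unitmx_scale (c : Kp) (M : 'M_2) : c != 0 -> M \in unitmx -> c *: M \in unitmx.
Proof. by move=> c0 Mu; rewrite unitmxZ // unitfE. Qed.

Lemma vertex_of_eq M N : M \in unitmx -> N \in unitmx -> vertex_of M = vertex_of N ->
  exists c U, [/\ c != 0, integral_GL U & N = c *: (M *m U)].
Proof.
move=> Mu Nu MN; have : vertex_of M (col_lattice N) by rewrite MN; apply: mem_vertex_of.
move=> [c /= c0 /col_lattice_eq[||U GU ->]] //; first exact: unitmx_scale.
by exists c, U; split=> //; rewrite scalemxAl.
Qed.

Definition cols (e1 e2 : 'cV[Kp]_2) : 'M[Kp]_2 :=
  \matrix_(i, j) (if j == 0 then e1 i 0 else e2 i 0).

Lemma cols_mul e1 e2 (z : 'cV_2) : cols e1 e2 *m z = z 0 0 *: e1 + z 1 0 *: e2.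
Proof.
apply/matrixP => i j; rewrite !mxE !big_ord_recl big_ord0 !mxE /= (ord1 j).
by rewrite (_ : lift _ _ = 1) ?addr0; [congr (_ + _); rewrite mulrC | apply: val_inj].
Qed.

Lemma colsE (M : 'M_2) : cols (col 0 M) (col 1 M) = M.
Proof.
apply/matrixP => i j; rewrite !mxE; case: ifP => [/eqP->|] //.
by case: j => [[|[|]]] // ? _; congr (M _ _); apply: val_inj.
Qed.

Lemma mulmx_cols (m : 'M_2) e1 e2 : m *m cols e1 e2 = cols (m *m e1) (m *m e2).
Proof.
apply/matrixP => i j; rewrite !mxE.
by case: ifP => j0; apply: eq_bigr => k _; rewrite mxE j0.
Qed.

Lemma free_cols e1 e2 : free [:: e1; e2] = (cols e1 e2 \in unitmx).
Proof.
have E (z : 'cV[Kp]_2) : cols e1 e2 *m z = \sum_(i < 2) z i 0 *: [tuple e1; e2]`_i.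
  rewrite cols_mul !big_ord_recl big_ord0 addr0 /=; congr (_ + _ *: _).
  by congr (z _ _); apply: val_inj.
apply/(@freeP _ _ _ [tuple e1; e2])/idP => [Hf | Mu k Ek].
  rewrite unitmxE unitfE -det_tr; apply/negP => /det0P[w w0 wM].
  case/negP: w0; apply/eqP/rowP => i; rewrite [RHS]mxE -[w]trmxK mxE.
  apply: (Hf (fun i => w^T i 0)); rewrite -E -[LHS]trmxK trmx_mul trmxK wM.
  by rewrite trmx0.
move=> i; pose z := \col_i k i.
suff /matrixP/(_ i 0) : z = 0 by rewrite !mxE.
rewrite -(mulKmx Mu z) E -[RHS](mulmx0 _ (invmx (cols e1 e2))); congr (_ *m _).
by rewrite -[RHS]Ek; apply: eq_bigr => j _; rewrite mxE.
Qed.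

Lemma col_lattice_cols e1 e2 : col_lattice (cols e1 e2) =
  [set y | exists s t, [/\ valuation_ring s, valuation_ring t & y = s *: e1 + t *: e2]].
Proof.
apply/seteqP; split=> [_ [z zi <-]|_ [s [t [si ti ->]]]].
  by exists (z 0 0), (z 1 0); split; [apply: zi | apply: zi | rewrite cols_mul].
exists (\col_i (if i == 0 then s else t)); last by rewrite cols_mul !mxE.
by move=> i j; rewrite mxE; case: ifP.
Qed.

Lemma RbasisP L e1 e2 :
  Rbasis L e1 e2 <-> cols e1 e2 \in unitmx /\ L = col_lattice (cols e1 e2).
Proof. by rewrite /Rbasis free_cols col_lattice_cols. Qed.

Lemma Rbasis_col_lattice M : M \in unitmx -> Rbasis (col_lattice M) (col 0 M) (col 1 M).
Proof. by move=> Mu; apply/RbasisP; rewrite colsE. Qed.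

Lemma homothety_vertex_of M :
  [set L' | exists2 c : Kp, c != 0 & L' = [set c *: y | y in col_lattice M]] = vertex_of M.
Proof.
have scal c : [set c *: y | y in col_lattice M] = col_lattice (c *: M).
  apply/seteqP; split=> [_ [_ [z zi <-] <-]|_ [z zi <-]].
    by exists z => //; rewrite scalemxAl.
  by exists (M *m z); [exists z | rewrite scalemxAl].
by apply/seteqP; split=> [_ [c c0 ->]|_ [c c0 <-]]; exists c; rewrite ?scal.
Qed.

Lemma is_vertexP P : is_vertex P <-> exists2 M, M \in unitmx & P = vertex_of M.
Proof.
split=> [[L [e1 [e2 [/RbasisP[Mu ->] ->]]]]|[M Mu ->]].
  by exists (cols e1 e2) => //; rewrite homothety_vertex_of.
exists (col_lattice M), (col 0 M), (col 1 M); split; first exact: Rbasis_col_lattice.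
by rewrite homothety_vertex_of.
Qed.

Lemma vertex_mem P M : M \in unitmx -> is_vertex P -> P (col_lattice M) -> P = vertex_of M.
Proof.
move=> Mu /is_vertexP[N Nu ->] [c /= c0 /col_lattice_eq[||U GU ->]] //.
  exact: unitmx_scale.
by rewrite vertex_ofM // vertex_of_scale.
Qed.

Lemma actM_vertex_of m M : actM m (vertex_of M) = vertex_of (m *m M).
Proof.
have latm N : [set m *m y | y in col_lattice N] = col_lattice (m *m N).
  apply/seteqP; split=> [_ [_ [z zi <-] <-]|_ [z zi <-]].
    by exists z => //; rewrite mulmxA.
  by exists (N *m z); [exists z | rewrite mulmxA].
apply/seteqP; split=> [_ [_ [c c0 <-] <-]|_ [c c0 <-]].
  by exists c => //; rewrite latm scalemxAr.
by exists (col_lattice (c *: M)); [exists c | rewrite latm scalemxAr].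
Qed.

Lemma actM_comp m n P : actM m (actM n P) = actM (m *m n) P.
Proof.
have img (L : set 'cV[Kp]_2) :
    [set m *m y | y in [set n *m y | y in L]] = [set (m *m n) *m y | y in L].
  apply/seteqP; split=> [_ [_ [z Lz <-] <-]|_ [z Lz <-]].
    by exists z; rewrite ?mulmxA.
  by exists (n *m z); [exists z | rewrite mulmxA].
apply/seteqP; split=> [_ [_ [L PL <-] <-]|_ [L PL <-]].
  by exists L; rewrite ?img.
by exists [set n *m y | y in L]; rewrite ?img //; exists L.
Qed.

Lemma actM1 P : actM 1%:M P = P.
Proof.
have img (L : set 'cV[Kp]_2) : [set 1%:M *m y | y in L] = L.
  apply/seteqP; split=> [_ [z Lz <-]|z Lz]; first by rewrite mul1mx.
  by exists z; rewrite ?mul1mx.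
apply/seteqP; split=> [_ [L PL <-]|L PL]; first by rewrite img.
by exists L; rewrite ?img.
Qed.

Lemma actM_vertex m P : m \in unitmx -> is_vertex P -> is_vertex (actM m P).
Proof.
move=> mu /is_vertexP[M Mu ->]; apply/is_vertexP; exists (m *m M).
  by rewrite unitmx_mul mu.
exact: actM_vertex_of.
Qed.

Lemma actM_distance m P Q d : m \in unitmx -> distance P Q d ->
  distance (actM m P) (actM m Q) d.
Proof.
move=> mu [L [L' [e1 [e2 [a [b [PL QL' LB L'B dE]]]]]]].
have RB N f1 f2 : Rbasis N f1 f2 -> Rbasis [set m *m y | y in N] (m *m f1) (m *m f2).
  move=> /RbasisP[Nu ->]; apply/RbasisP; rewrite -mulmx_cols unitmx_mul mu; split=> //.
  apply/seteqP; split=> [_ [_ [z zi <-] <-]|_ [z zi <-]].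
    by exists z => //; rewrite mulmxA.
  by exists (cols f1 f2 *m z); [exists z | rewrite mulmxA].
exists [set m *m y | y in L], [set m *m y | y in L'], (m *m e1), (m *m e2), a, b.
split=> //; [by exists L | by exists L' | exact: RB|].
by rewrite !scalemxAr; apply: RB.
Qed.

Definition unif_diag (a b : int) : 'M[Kp]_2 :=
  \matrix_(i, j) (if i == j then (if i == 0 then pi ^ a else pi ^ b) else 0).

Lemma det_unif_diag a b : \det (unif_diag a b) = pi ^ a * pi ^ b.
Proof. by rewrite det22 !mxE /= mul0r subr0. Qed.

Lemma cols_unif_diag e1 e2 a b : cols (pi ^ a *: e1) (pi ^ b *: e2) = cols e1 e2 *m unif_diag a b.
Proof.
apply/matrixP => i j; rewrite !mxE !big_ord_recl big_ord0 !mxE /= addr0.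
by case: j => [[|[|]]] //= ?; rewrite !mulr0 ?addr0 ?add0r mulrC.
Qed.

Lemma unif_diag_scale a b : unif_diag a b = pi ^ a *: unif_diag 0 (b - a).
Proof.
apply/matrixP => i j; rewrite !mxE; case: ifP => _; last by rewrite mulr0.
case: ifP => _; first by rewrite expr0z mulr1.
by rewrite -expfzDr ?cunif_neq0 //; congr (_ ^ _); ring.
Qed.

Lemma unif_diag_scaler a b : unif_diag a b = pi ^ b *: unif_diag (a - b) 0.
Proof.
apply/matrixP => i j; rewrite !mxE; case: ifP => _; last by rewrite mulr0.
case: ifP => _; last by rewrite expr0z mulr1.
by rewrite -expfzDr ?cunif_neq0 //; congr (_ ^ _); ring.
Qed.

(** Adjacent lattices have bases that differ by diagonal matrices with exponents
    [a] and [b] at distance 1; up to a scalar one exponent is 0 and the other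
    one is 1. *)
Lemma distance_step M Q : M \in unitmx -> is_vertex Q -> distance (vertex_of M) Q 1 ->
  exists D, [/\ integral_mx D, \det D != 0, v (\det D) = 1 & Q = vertex_of (M *m D)].
Proof.
move=> Mu Qv [L [L' [e1 [e2 [a [b [[c /= c0 <-] QL' /RbasisP[Nu NE] /RbasisP[N'u N'E] ab]]]]]]].
have [|U [Ui U0 vU] {}NE] := col_lattice_eq _ Nu NE; first exact: unitmx_scale.
rewrite cols_unif_diag in N'E N'u.
have {N'E} QE : Q = vertex_of (M *m (U *m unif_diag a b)).
  rewrite N'E in QL'; rewrite (vertex_mem N'u Qv QL') NE -!scalemxAl vertex_of_scale //.
  by rewrite mulmxA.
have int_unif_diag (k l : nat) : integral_mx (unif_diag k l).
  move=> i j; rewrite mxE; case: ifP => _; last by left.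
  by case: ifP => _; right; rewrite cval_unifX.
have [bE|bE] : (b - a = 1) \/ (a - b = 1) by lia.
- exists (U *m unif_diag 0 1); split.
  + by apply: integral_mx_mul => //; apply: (int_unif_diag 0%N 1%N).
  + by rewrite det_mulmx det_unif_diag !mulf_neq0 ?cunifX_neq0.
  + by rewrite det_mulmx det_unif_diag !cvalM ?mulf_neq0 ?cunifX_neq0 // vU !cval_unifX.
  by rewrite QE unif_diag_scale bE -!scalemxAr vertex_of_scale ?cunifX_neq0.
exists (U *m unif_diag 1 0); split.
- by apply: integral_mx_mul => //; apply: (int_unif_diag 1%N 0%N).
- by rewrite det_mulmx det_unif_diag !mulf_neq0 ?cunifX_neq0.
- by rewrite det_mulmx det_unif_diag !cvalM ?mulf_neq0 ?cunifX_neq0 // vU !cval_unifX.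
by rewrite QE unif_diag_scaler bE -!scalemxAr vertex_of_scale ?cunifX_neq0.
Qed.

Lemma distance_unif_diag M : M \in unitmx ->
  distance (vertex_of M) (vertex_of (M *m unif_diag 0 1)) 1.
Proof.
move=> Mu; exists (col_lattice M), (col_lattice (M *m unif_diag 0 1)), (col 0 M), (col 1 M), 0, 1.
split=> //; try exact: mem_vertex_of.
  exact: Rbasis_col_lattice.
apply/RbasisP; rewrite cols_unif_diag colsE; split=> //.
by rewrite unitmx_mul Mu unitmxE det_unif_diag unitfE mulf_neq0 ?cunifX_neq0.
Qed.

(** Multiply the integral matrices of the steps. Their product need not be
    primitive, which is how backtracking shows up. *)
Lemma walk_int M Q n w : M \in unitmx -> walk (vertex_of M) Q n w ->
  exists Z, [/\ integral_mx Z, \det Z != 0, v (\det Z) = n & Q = vertex_of (M *m Z)].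
Proof.
move=> Mu [w0 <- wv wd] {Q}; elim: n wv wd => [|n IHn] wv wd.
  by exists 1%:M; rewrite det1 oner_neq0 cval1 mulmx1; split=> //; apply: integral_mx1.
have [i lin|i lin|Z [Zi Z0 vZ wE]] := IHn.
- by apply: wv; apply: ltnW.
- by apply: wd; apply: ltnW.
have MZu : M *m Z \in unitmx by rewrite unitmx_mul Mu unitmxE unitfE.
have := wd n (ltnSn n); rewrite wE => /(distance_step MZu (wv _ (leqnn _)))[D [Di D0 vD DE]].
exists (Z *m D); split; [exact: integral_mx_mul | by rewrite det_mulmx mulf_neq0| |].
  by rewrite det_mulmx cvalM // vZ vD; lia.
by rewrite DE mulmxA.
Qed.

Definition primitive_mx (Z : 'M[Kp]_2) : Prop :=
  integral_mx Z /\ exists i j, Z i j != 0 /\ v (Z i j) = 0.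

Lemma primitive_mx_scale c Z : c != 0 -> primitive_mx Z -> integral_mx (c *: Z) -> 0 <= v c.
Proof.
move=> c0 [Zi [i [j [Z0 vZ]]]] /(_ i j); rewrite mxE.
by move/val_ge_unit; rewrite mulf_neq0 // cvalM // vZ addr0; apply.
Qed.

Lemma primitive_mx_mul U Z : integral_GL U -> primitive_mx Z -> primitive_mx (U *m Z).
Proof.
move=> GU Zp; have [Ui _ _] := GU.
have UZi : integral_mx (U *m Z) by apply/integral_mx_mul/(proj1 Zp).
split=> //; have [//|Hn] := pselect (exists i j, (U *m Z) i j != 0 /\ v ((U *m Z) i j) = 0).
have UZ1 : integral_mx (pi ^ (- 1) *: (U *m Z)).
  move=> i j; rewrite mxE -[0](addNr 1); apply: val_geM.
    by right; rewrite cval_unifX.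
  have [->|UZ0] := eqVneq ((U *m Z) i j) 0; first by left.
  right; have := val_ge_unit UZ0 (UZi i j); rewrite le_eqVlt.
  move=> /predU1P[vUZ|]; last by rewrite gtz0_ge1.
  by case: Hn; exists i, j.
have /(primitive_mx_scale (cunifX_neq0 Kp (- 1)) Zp) : integral_mx (pi ^ (- 1) *: Z).
  rewrite -(mulKmx (integral_GL_unit GU) Z) scalemxAr.
  by apply: integral_mx_mul => //; case: (integral_GL_inv GU).
by rewrite cval_unifX.
Qed.

(** Factor out the least valuation of the entries. *)
Lemma primitive_mx_exists (Z : 'M[Kp]_2) : Z != 0 ->
  exists (k : int) Y, primitive_mx Y /\ Z = pi ^ k *: Y.
Proof.
move=> Z0; have [[i j] Zij] : exists ij : 'I_2 * 'I_2, Z ij.1 ij.2 != 0.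
  apply/existsP; apply: contraNT Z0; rewrite negb_exists => /forallP Z0.
  by apply/eqP/matrixP => i j; have := Z0 (i, j); rewrite negbK => /eqP->; rewrite mxE.
pose f (ij : 'I_2 * 'I_2) := v (Z ij.1 ij.2).
have [[i0 j0] /= Zij0 Hmin] :=
  @arg_minP _ _ _ (i, j) (fun ij => Z ij.1 ij.2 != 0) f Zij.
exists (f (i0, j0)), (pi ^ (- f (i0, j0)) *: Z); split; last first.
  by rewrite scalerA -expfzDr ?cunif_neq0 // subrr expr0z scale1r.
split=> [k l|].
  rewrite mxE; have [->|Zkl] := eqVneq (Z k l) 0; first by left; rewrite mulr0.
  right; rewrite cvalM ?cunifX_neq0 // cval_unifX.
  by have := Hmin (k, l) Zkl; rewrite /f /=; lia.
exists i0, j0; rewrite mxE mulf_neq0 ?cunifX_neq0 // cvalM ?cunifX_neq0 //.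
by rewrite cval_unifX /f /= addNr.
Qed.

(** Smith normal form: an entry is a unit, permutations bring it to the top left
    corner, and it serves as pivot. *)
Lemma primitive_mx_smith Z n : primitive_mx Z -> \det Z != 0 -> v (\det Z) = n ->
  exists U W, [/\ integral_GL U, integral_GL W & Z = U *m unif_diag 0 n *m W].
Proof.
move=> Zp; have main Y : integral_mx Y -> Y 0 0 != 0 -> v (Y 0 0) = 0 -> \det Y != 0 ->
    v (\det Y) = n -> exists U W, [/\ integral_GL U, integral_GL W & Y = U *m unif_diag 0 n *m W].
  move=> Yi Y0 vY dY vdY.
  (* Eliminate with the top left entry; [e] is the unit left in the bottom right corner. *)
  pose U : 'M[Kp]_2 := \matrix_(i, j) (if i == j then 1 else if i == 0 then 0 else Y 1 0 / Y 0 0).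
  pose e := \det Y / Y 0 0 / pi ^ n.
  pose W : 'M[Kp]_2 := \matrix_(i, j) (if i == 0 then Y 0 j else if j == 0 then 0 else e).
  have e0 : e != 0 by rewrite /e !mulf_eq0 !invr_eq0 !negb_or dY Y0 cunifX_neq0.
  have ve : v e = 0.
    rewrite cvalM ?invr_eq0 ?cunifX_neq0 //; last by rewrite mulf_neq0 ?invr_eq0.
    by rewrite cvalM ?invr_eq0 // !cvalV ?cunifX_neq0 // vY vdY cval_unifX; lia.
  have detU : \det U = 1 by rewrite det22 !mxE /= mul0r mulr1 subr0.
  have detW : \det W = Y 0 0 * e by rewrite det22 !mxE /= mulr0 subr0.
  exists U, W; split.
  - split; rewrite ?detU ?oner_neq0 ?cval1 // => i j; rewrite mxE.
    case: ifP => _; first exact: val_ge1.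
    case: ifP => _; first by left.
    rewrite -[0]addr0; apply: val_geM; first exact: Yi.
    by right; rewrite cvalV // vY.
  - split; last by rewrite detW (cvalM Y0 e0) vY ve.
      move=> i j; rewrite mxE; case: ifP => _; first exact: Yi.
      by case: ifP => _; [left | right; rewrite ve].
    by rewrite detW (mulf_neq0 Y0 e0).
  have pn0 := cunifX_neq0 Kp n.
  have dE : \det Y = Y 0 0 * pi ^ n * e by rewrite /e mulrA mulrC mulrA; field; rewrite Y0 pn0.
  have {}dE : Y 1 1 = Y 1 0 / Y 0 0 * Y 0 1 + pi ^ n * e.
    by apply: (mulfI Y0); move: dE; rewrite det22 => /(canRL (subrK _)) ->; field.
  apply: matrix22P; rewrite !mulmx22 !mxE /= expr0z; try by rewrite /W /U; field.
  by rewrite dE; field.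
(* Multiplication by [w] exchanges rows or columns. *)
pose w : 'M[Kp]_2 := \matrix_(i, j) (i != j)%:R.
have ww : w *m w = 1%:M by apply: matrix22P; rewrite mulmx22 !mxE /=; ring.
have detw : \det w = -1 by rewrite det22 !mxE /=; ring.
have Gw : integral_GL w.
  split; rewrite ?detw ?oppr_eq0 ?oner_eq0 ?cvalN1 // => i j.
  by rewrite mxE; case: (_ != _); [apply: val_ge1 | left].
pose P i := if i == 0 :> 'I_2 then 1%:M else w.
have PP i : P i *m P i = 1%:M by rewrite /P; case: ifP => _; rewrite ?mulmx1.
have GP i : integral_GL (P i) by rewrite /P; case: ifP => _ //; apply: integral_GL1.
have vdetP i : \det (P i) != 0 /\ v (\det (P i)) = 0 by case: (GP i).
case: Zp => Zi [i [j [Zij vZij]]] dZ vdZ.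
have Pe k l (Y : 'M_2) : (P k *m Y) 0 l = Y k l.
  rewrite /P; case: ifP => [/eqP->|]; first by rewrite mul1mx.
  case: k => [[|[|]]] // ? _; rewrite mulmx22 !mxE /= mul0r add0r mul1r.
  by congr (Y _ _); apply: val_inj.
have Pe' k l (Y : 'M_2) : (Y *m P l) k 0 = Y k l.
  rewrite /P; case: ifP => [/eqP->|]; first by rewrite mulmx1.
  case: l => [[|[|]]] // ? _; rewrite mulmx22 !mxE /= mulr0 add0r mulr1.
  by congr (Y _ _); apply: val_inj.
have [dPi vPi] := vdetP i; have [dPj vPj] := vdetP j.
have [|||||U [W [GU GW YE]]] := main (P i *m Z *m P j).
- by apply: integral_mx_mul; [apply: integral_mx_mul|] => //; [case: (GP i) | case: (GP j)].
- by rewrite Pe' Pe.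
- by rewrite Pe' Pe.
- by rewrite !det_mulmx !mulf_neq0.
- by rewrite !det_mulmx !cvalM ?mulf_neq0 // vPi vPj vdZ; lia.
exists (P i *m U), (W *m P j); split; try exact: integral_GL_mul.
have -> : Z = P i *m (P i *m Z *m P j) *m P j.
  by rewrite -!mulmxA PP mulmx1 !mulmxA PP mul1mx.
by rewrite YE !mulmxA.
Qed.

(** The combinatorial distance, to which [on_segment] refers; [mindist_prim] compares
    it with elementary divisors. *)
Definition mindist P Q (n : nat) : Prop :=
  (exists w, walk P Q n w) /\ forall m w, walk P Q m w -> (n <= m)%N.

Lemma mindist_uniq P Q n m : mindist P Q n -> mindist P Q m -> n = m.
Proof.
by move=> [[w wn] nmin] [[w' wm] mmin]; apply/eqP;
  rewrite eqn_leq (nmin _ _ wm) (mmin _ _ wn).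
Qed.

(** By the Smith normal form a primitive [Z] gives a walk whose length is the
    valuation of its determinant. Conversely the integral matrix of any walk with
    the same ends is an integral multiple of [Z] up to integral invertible
    matrices, so its determinant has at least the valuation of that of [Z]. *)
Lemma mindist_prim M Z (n : nat) : M \in unitmx -> primitive_mx Z -> \det Z != 0 ->
  v (\det Z) = n -> mindist (vertex_of M) (vertex_of (M *m Z)) n.
Proof.
move=> Mu Zp Z0 vZ; have [U [W [GU GW ZE]]] := primitive_mx_smith Zp Z0 vZ.
have uM (k : int) : M *m U *m unif_diag 0 k \in unitmx.
  rewrite !unitmx_mul Mu integral_GL_unit //= unitmxE det_unif_diag unitfE.
  by rewrite mulf_neq0 ?cunifX_neq0.
split.
  exists (fun i : nat => vertex_of (M *m U *m unif_diag 0 i)); split=> [||i _|i _].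
  - rewrite -[RHS](vertex_ofM _ GU); congr vertex_of.
    suff -> : unif_diag 0 0%N = 1%:M by rewrite mulmx1.
    by apply: matrix22P; rewrite !mxE /= ?expr0z.
  - by rewrite -(vertex_ofM _ GW) ZE !mulmxA.
  - by apply/is_vertexP; exists (M *m U *m unif_diag 0 i).
  suff E : unif_diag 0 i *m unif_diag 0 1 = unif_diag 0 i.+1.
    by have := distance_unif_diag (uM i); rewrite -(mulmxA (M *m U)) E.
  apply: matrix22P; rewrite mulmx22 !mxE /= ?expr0z; try ring.
  by rewrite intS expfzDr ?cunif_neq0 //; ring.
move=> m w /(walk_int Mu)[Y [Yi Y0 vY /vertex_of_eq[||c [V [c0 /[dup] GV [Vi V0 vV] YE]]]]].
- by rewrite unitmx_mul Mu unitmxE unitfE.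
- by rewrite unitmx_mul Mu unitmxE unitfE.
have {}YE : Y = c *: (Z *m V).
  by apply: (can_inj (mulKmx Mu)); rewrite YE -scalemxAr mulmxA.
have YV : c *: Z = Y *m invmx V.
  by rewrite YE -scalemxAl mulmxK // integral_GL_unit.
have /(primitive_mx_scale c0 Zp) vc : integral_mx (c *: Z).
  by rewrite YV; apply: integral_mx_mul => //; case: (@integral_GL_inv V).
have : v (\det Y) = n%:Z + (v c + v c).
  by rewrite YE detZ expr2 det_mulmx !cvalM ?mulf_neq0 // vZ vV; lia.
by rewrite vY; lia.
Qed.

(** A step multiplies the matrix of a vertex by a matrix whose determinant has
    valuation 1, while matrices of the same vertex have determinants whose
    valuations differ by an even number. *)
Lemma distance_irr P : is_vertex P -> ~ distance P P 1.
Proof.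
move=> /[dup] Pv /is_vertexP[M Mu PE]; rewrite {1}PE => /(distance_step Mu Pv)[D [Di D0 vD]].
rewrite PE => /vertex_of_eq[||c [U [c0 [Ui U0 vU] E]]] //.
  by rewrite unitmx_mul Mu unitmxE unitfE.
have {}E : D = c *: U by apply: (can_inj (mulKmx Mu)); rewrite E -scalemxAr.
have : v (\det D) = v c + v c.
  by rewrite E detZ expr2 !cvalM ?mulf_neq0 // vU; lia.
by rewrite vD; lia.
Qed.

Lemma walk_cons P V Q n w : is_vertex P -> distance P V 1 -> walk V Q n w ->
  walk P Q n.+1 (fun i => if i is i'.+1 then w i' else P).
Proof.
by move=> Pv PV [w0 wn wv wd]; split=> // -[|i] // lin; rewrite ?w0 //; [apply: wv | apply: wd].
Qed.

Lemma walk_drop P Q n w i : (i <= n)%N -> walk P Q n w ->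
  walk (w i) Q (n - i) (fun j => w (i + j)%N).
Proof.
move=> lin [w0 wn wv wd]; split=> [||j lj|j lj]; rewrite ?addn0 ?subnKC //.
  by apply: wv; lia.
by rewrite addnS; apply: wd; lia.
Qed.

Lemma segment_exists P Q n : mindist P Q n.+1 ->
  exists V, [/\ is_vertex V, distance P V 1 & on_segment P Q V].
Proof.
move=> [[w ww] wmin]; have [w0 wn wv wd] := ww.
exists (w 1%N); rewrite -{1}w0; split; [exact: wv | exact: wd |].
by exists n.+1, w; split=> //; exists 1%N.
Qed.

(** On a shortest walk from [P], a vertex of index [i] that is also adjacent to [P]
    can be reached in one step; hence [i] is at most 1, and it is not 0 by
    [distance_irr]. *)
Lemma segment_next P Q V n : is_vertex P -> mindist P Q n.+1 -> distance P V 1 ->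
  on_segment P Q V -> mindist V Q n.
Proof.
move=> Pv PQ PV [m [w [ww wmin [i lim VE]]]].
have nm : m = n.+1 by apply: (@mindist_uniq P Q) => //; split=> //; exists w.
subst m; have wV := walk_drop lim ww; rewrite -VE in wV.
have i1 : i = 1%N.
  have := wmin _ _ (walk_cons Pv PV wV); have [i0|] := posnP i; last lia.
  by case: (distance_irr Pv); rewrite {2}(_ : P = V) // VE i0; case: ww.
subst i; split; first by eexists; rewrite subSS subn0 in wV; apply: wV.
by move=> m w' /(walk_cons Pv PV)/wmin.
Qed.

Lemma mindist_act m P Q n : m \in unitmx -> mindist P Q n ->
  mindist (actM m P) (actM m Q) n.
Proof.
have walk_act m' P' Q' k w : m' \in unitmx -> walk P' Q' k w ->
    walk (actM m' P') (actM m' Q') k (fun i => actM m' (w i)).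
  move=> mu [w0 wn wv wd]; split=> [||i lik|i lik]; rewrite ?w0 ?wn //.
    by apply: actM_vertex => //; apply: wv.
  by apply: actM_distance => //; apply: wd.
move=> mu [[w ww] wmin]; split; first by eexists; apply: walk_act ww.
move=> k w' /(walk_act (invmx m) _ _ _ _); rewrite unitmx_inv => /(_ mu).
by rewrite !actM_comp mulVmx // !actM1 => /wmin.
Qed.

End Tree.

(** * Integrality of traces and norms *)

Section QuadraticIntegrality.
Variable K : fieldExtType rat.
Local Notation ZK := (@ringOfIntegers K).

Lemma integral_field_descent (L : fieldType) (h : {rmorphism K -> L}) y :
  integralOver (h \o (intr : int -> K)) (h y) -> ZK y.
Proof.
by move=> [q mon_q]; rewrite map_poly_comp fmorph_root => qy; exists q.
Qed.

Lemma size_quadratic (t n : K) : size ('X^2 - t *: 'X + n%:P) = 3.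
Proof.
rewrite -addrA size_polyDl size_polyXn //.
rewrite ltnS -scaleNr -mul_polyC size_MXaddC; case: ifP => // _.
exact: leq_ltn_trans (size_polyC_leq1 _) _.
Qed.

(** The roots of a quadratic factor of a monic polynomial with integral
    coefficients are integral in a splitting field, hence so are their sum and
    their product. *)
Lemma quadratic_factor_integral (chi : {poly K}) t n :
  chi \is monic -> (forall i, ZK chi`_i) -> 'X^2 - t *: 'X + n%:P %| chi ->
  ZK t /\ ZK n.
Proof.
set f := _ + n%:P => mon_chi Zchi f_chi.
have size_f : size f = 3 by apply: size_quadratic.
have [L [h [z hz]]] : exists (L : fieldType) (h : {rmorphism K -> L}) z,
    root (map_poly h f) z.
  have [[z fz]|nof] := pselect (exists z, root f z).
    by exists K, idfun, z; rewrite map_poly_id.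
  have : irreducible_poly f.
    apply: cubic_irreducible; rewrite ?size_f // => x.
    by apply/negP => fx; apply: nof; exists x.
  by move/irredp_FAdjoin => [L _ [z hz _]]; exists L, (in_alg L), z.
have fE y : (map_poly h f).[y] = y ^+ 2 - h t * y + h n.
  rewrite /f rmorphD rmorphB /= map_polyC map_polyZ map_polyXn map_polyX.
  by rewrite !hornerE.
have hn : h n = z * (h t - z).
  by move/rootP: hz; rewrite fE => /eqP; rewrite addr_eq0 => /eqP nE;
    rewrite -[h n]opprK -nE; ring.
have int_root y : root (map_poly h f) y -> integralOver (h \o intr) y.
  move=> fy; apply: (@integral_root_monic _ _ (h \o intr) y (map_poly h chi)).
  - exact: monic_map.
  - by apply: root_dvdp fy; rewrite dvdp_map.
  apply/integral_poly => i; rewrite coef_map; exact/integral_rmorph/Zchi.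
have Iz := int_root z hz.
have Iz' : integralOver (h \o intr) (h t - z).
  by apply: int_root; rewrite /root fE hn; apply/eqP; ring.
split; apply: (@integral_field_descent L h).
  by rewrite -[h t](subrK z); apply: integral_add.
by rewrite hn; apply: integral_mul.
Qed.

End QuadraticIntegrality.

Section Multiplier.
Variables (K : fieldExtType rat) (A : falgType K).
Local Notation ZK := (@ringOfIntegers K).

Lemma ZK_coef_det n (M : 'M[{poly K}]_n) :
  (forall i j k, ZK (M i j)`_k) -> forall k, ZK (\det M)`_k.
Proof.
pose T (q : {poly K}) := forall k, ZK q`_k.
have T0 : T 0 by move=> k; rewrite coef0; apply: ZK0.
have TD q r : T q -> T r -> T (q + r).
  by move=> Tq Tr k; rewrite coefD; apply: ZKD.
have TM q r : T q -> T r -> T (q * r).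
  move=> Tq Tr k; rewrite coefM; apply: (big_ind (fun x => ZK x)) => [|x y|i _].
  - exact: ZK0.
  - exact: ZKD.
  by apply: ZKM.
have T1 : T 1 by move=> k; rewrite coef1; apply: (ZKint _ (_ == _ :> nat)).
move=> TM_M; change (T (\det M)); apply: (big_ind T) => // s _.
apply: (TM); last by apply: (big_ind T) => // i _ k; apply: TM_M.
by rewrite -signr_odd; case: odd => // k; rewrite coefN; apply/ZKN/T1.
Qed.

(** The theorem of Cayley and Hamilton, for the matrix of the multiplication by [x]
    on a finite family of generators: the value of its characteristic polynomial
    at [x] kills the generators, hence the whole algebra. *)
Lemma multiplier_integral (N : set A) x : lattice N -> (forall y, N y -> N (x * y)) ->
  exists chi : {poly K},
    [/\ chi \is monic, forall i, ZK chi`_i & horner_alg x chi = 0].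
Proof.
move=> [[n [e NE]] Nspan] xN.
have Ne i : N (e i).
  by rewrite NE -[e i]scale1r; apply: span_mul_gen; [apply: ZK1 | exists i].
have /choice[m xe] i : exists s : 'I_n -> K,
    (forall j, ZK (s j)) /\ x * e i = \sum_j s j *: e j.
  have := xN _ (Ne i); rewrite {1}NE => /span_mul_range[||s Zs ->].
  - exact: ZK0.
  - exact: ZKD.
  by exists s.
have killN y : (forall i, y * e i = 0) -> y = 0.
  move=> ye; have yN z : N z -> y * z = 0.
    rewrite NE; move: z.
    apply: (@span_mul_ind _ _ _ _ [set z | y * z = 0]) => [|z w|s _ _ [i _ <-]] /=.
    - by rewrite mulr0.
    - by move=> yz yw; rewrite mulrDr yz yw addr0.
    by rewrite -scalerAr ye scaler0.
  have : span_mul setT N 1 by rewrite Nspan.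
  rewrite -[y]mulr1; move: 1.
  apply: (@span_mul_ind _ _ _ _ [set z | y * z = 0]) => [|z w|s z _ /yN yz] /=.
  - by rewrite mulr0.
  - by move=> yz yw; rewrite mulrDr yz yw addr0.
  by rewrite -scalerAr yz scaler0.
case: n => [|n] in e m NE Ne xe killN *.
  by have /eqP := killN 1 (fun i => match i with Ordinal _ h => match notF h with end end); rewrite oner_eq0.
pose M : 'M[K]_n.+1 := \matrix_(i, j) m i j.
have hornerM (q : {poly K}) i :
    horner_alg x q * e i = \sum_j (horner_mx M q) i j *: e j.
  elim/poly_ind: q i => [|q c IHq] i.
    by rewrite !rmorph0 mul0r big1 // => j _; rewrite mxE scale0r.
  have -> : horner_alg x (q * 'X + c%:P) = x * horner_alg x q + c%:A.
    by rewrite mulrC rmorphD rmorphM /= horner_algX horner_algC.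
  rewrite rmorphD rmorphM /= horner_mx_X horner_mx_C mulrDl -mulrA IHq.
  have -> : c%:A * e i = \sum_j (c%:M : 'M_n.+1) i j *: e j.
    rewrite (bigD1 i) //= mxE eqxx mulr1n big1 ?addr0 ?mulr_algl // => j ji.
    by rewrite mxE eq_sym (negPf ji) scale0r.
  have -> : x * (\sum_j horner_mx M q i j *: e j) =
      \sum_j (horner_mx M q * M) i j *: e j.
    rewrite mulr_sumr (eq_bigr (fun j => \sum_k (horner_mx M q i j * M j k) *: e k)).
      rewrite exchange_big; apply: eq_bigr => k _ /=.
      by rewrite mxE scaler_suml.
    move=> j _; rewrite -scalerAr (proj2 (xe j)) scaler_sumr.
    by apply: eq_bigr => k _; rewrite scalerA mxE.
  by rewrite -big_split; apply: eq_bigr => k _ /=; rewrite -scalerDl [in RHS]mxE.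
exists (char_poly M); split; first exact: char_poly_monic.
  apply: ZK_coef_det => i j k; rewrite !mxE coefB coefMn coefX coefC.
  apply: ZKB; last by case: ifP => _; [case: (xe i) | apply: ZK0].
  by case: (i == j); case: (k == 1%N); rewrite ?mulr1n ?mulr0n; (exact: ZK1 || exact: ZK0).
by apply: killN => i; rewrite hornerM Cayley_Hamilton big1 // => j _; rewrite mxE scale0r.
Qed.

End Multiplier.

(** * Conjugation, trace and norm in a quaternion algebra *)

Section Quaternion.
Variables (K : fieldExtType rat) (A : falgType K) (H : quaternion_algebra A).
Local Notation ZK := (@ringOfIntegers K).

Local Notation B := [tuple 1; qi H; qj H; qi H * qj H].

Definition trd (x : A) : K := 2%:R * coord B (inord 0) x.

(** This is the standard involution: on the quaternion basis it changes the sign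
    of the three elements other than 1. *)
Definition conjq (x : A) : A := (trd x)%:A - x.

Let o0 : (inord 0 : 'I_4) = 0 :> nat. Proof. by rewrite inordK. Qed.
Let o1 : (inord 1 : 'I_4) = 1%N :> nat. Proof. by rewrite inordK. Qed.
Let o2 : (inord 2 : 'I_4) = 2 :> nat. Proof. by rewrite inordK. Qed.
Let o3 : (inord 3 : 'I_4) = 3 :> nat. Proof. by rewrite inordK. Qed.

Lemma quaternionE x : x = coord B (inord 0) x *: 1 + coord B (inord 1) x *: qi H +
  coord B (inord 2) x *: qj H + coord B (inord 3) x *: (qi H * qj H).
Proof.
rewrite {1}(coord_basis (qbasis H) (memvf x)) !big_ord_recl big_ord0 addr0 /= !addrA.
congr (_ *: _ + _ *: _ + _ *: _ + _ *: _); congr (coord _ _ x);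
  by apply: val_inj; rewrite /= ?o0 ?o1 ?o2 ?o3.
Qed.

Lemma coord_scalar (s : K) (k : nat) : (k < 4)%N ->
  coord B (inord k) s%:A = if k == 0 then s else 0.
Proof.
move=> k4; rewrite linearZ /=.
have := coord_free (inord 0) (inord k) (basis_free (qbasis H)).
rewrite -[inord 0 == _]val_eqE /= o0 inordK //= => ->.
by rewrite eq_sym; case: eqP => _; rewrite ?mulr1 ?mulr0.
Qed.

Lemma trd_scalar s : trd s%:A = 2%:R * s.
Proof. by rewrite /trd coord_scalar. Qed.

Lemma nrd_scalar s : nrd H s%:A = s ^+ 2.
Proof. by rewrite /nrd !coord_scalar //=; ring. Qed.

Let II := qi_sqr H.
Let JJ := qj_sqr H.
Let JI := qji H.

(** The three pure basis quaternions anticommute pairwise, so that the square of a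
    pure quaternion is the sum of the squares of its three components. *)
Lemma anticommute_sqr (x y : A) : x * y = - (y * x) -> (x + y) * (x + y) = x * x + y * y.
Proof.
by move=> xy; rewrite mulrDl !mulrDr xy addrA -[_ - _ + _]addrA addNr addr0.
Qed.

Lemma mul_conjq x : x * conjq x = (nrd H x)%:A.
Proof.
pose a := qa H; pose b := qb H; pose i := qi H; pose j := qj H.
have [t [u [w [z [xE tE nE]]]]] : exists t u w z : K,
    [/\ x = t%:A + (u *: i + w *: j + z *: (i * j)), trd x = 2%:R * t &
        nrd H x = t ^+ 2 - a * u ^+ 2 - b * w ^+ 2 + a * b * z ^+ 2].
  exists (coord B (inord 0) x), (coord B (inord 1) x), (coord B (inord 2) x),
    (coord B (inord 3) x); split=> //.
  by rewrite {1}[x]quaternionE !addrA.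
have anti s s' (y y' : A) : y * y' = - (y' * y) ->
    (s *: y) * (s' *: y') = - ((s' *: y') * (s *: y)).
  by move=> yy; rewrite -!scalerAl -!scalerAr yy !scalerN !scalerA mulrC.
have iL : i * (i * j) = - (i * j * i) by rewrite -[i * j * i]mulrA JI mulrN opprK.
have jL : j * (i * j) = - (i * j * j) by rewrite mulrA JI mulNr.
have ij : i * j = - (j * i) by rewrite JI opprK.
have qq : (u *: i + w *: j + z *: (i * j)) * (u *: i + w *: j + z *: (i * j)) =
    (u ^+ 2 * a + w ^+ 2 * b - z ^+ 2 * (a * b))%:A.
  have aL : (u *: i + w *: j) * (z *: (i * j)) = - (z *: (i * j) * (u *: i + w *: j)).
    by rewrite mulrDl mulrDr opprD (anti _ _ _ _ iL) (anti _ _ _ _ jL).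
  rewrite (anticommute_sqr aL) (anticommute_sqr (anti _ _ _ _ ij)).
  have LL : (i * j) * (i * j) = - (a * b)%:A.
    rewrite mulrA -[i * j * i]mulrA JI mulrN mulNr mulrA II mulr_algl.
    by rewrite -scalerAl JJ scalerA.
  have sqZ s (y : A) : (s *: y) * (s *: y) = s ^+ 2 *: (y * y).
    by rewrite -scalerAl -scalerAr scalerA.
  rewrite !sqZ II JJ LL scalerN !scalerA.
  by rewrite -scalerDl -scalerBl.
set q := _ + z *: _ in qq xE.
have -> : conjq x = t%:A - q.
  by rewrite /conjq tE xE opprD addrA -scalerBl; congr (_ *: _ - _); ring.
rewrite nE xE mulrDl !mulrBr qq !mulr_algl mulr_algr scalerA.
rewrite addrA subrK -scalerBl; congr (_ *: _); ring.
Qed.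

Lemma nrdZ s x : nrd H (s *: x) = s ^+ 2 * nrd H x.
Proof. by rewrite /nrd !linearZ /=; ring. Qed.

Lemma nrd_unit x : nrd H x != 0 -> x \is a GRing.unit.
Proof.
move=> x0; apply/unitrP; exists ((nrd H x)^-1 *: conjq x).
have xx : conjq x * x = x * conjq x by rewrite /conjq mulrBl mulrBr mulr_algl mulr_algr.
by rewrite -scalerAl -scalerAr xx mul_conjq scalerA mulVf // scale1r.
Qed.

Section Matrices.
Variables (L : fieldType) (iota : {rmorphism K -> L}) (phi : {rmorphism A -> 'M[L]_2}).
Hypothesis phiZ : forall a x, phi (a *: x) = iota a *: phi x.

Let two_neq0 : 2%:R != 0 :> L.
Proof.
rewrite -(rmorph_nat iota) fmorph_eq0 -(rmorph_nat (in_alg K : rat -> K)) fmorph_eq0.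
by [].
Qed.

(** Conjugation by the invertible matrix [Y] sends [X] to its opposite, and 2 is
    invertible. *)
Lemma anticommute_mxtrace (X Y : 'M[L]_2) c : c != 0 -> Y * Y = c%:M ->
  X * Y = - (Y * X) -> \tr X = 0.
Proof.
move=> c0 YY XY; have : c *: X = - (Y * (X * Y)).
  by rewrite XY mulrN opprK mulrA YY -mul_scalar_mx.
move/(congr1 mxtrace); rewrite mxtraceZ raddfN /= -!mulmxE mxtrace_mulC -mulmxA.
rewrite [Y *m Y]YY mul_mx_scalar mxtraceZ => /eqP.
rewrite -addr_eq0 -mulr2n -mulr_natl !mulf_eq0 (negPf two_neq0) (negPf c0).
by move/eqP.
Qed.

Lemma phi_scalar s : phi s%:A = (iota s)%:M.
Proof. by rewrite phiZ rmorph1 scalemx1. Qed.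

(** The three pure basis quaternions anticommute in pairs and have invertible
    images, so their images have trace 0. *)
Lemma mxtrace_phi x : \tr (phi x) = iota (trd x).
Proof.
have a0 : iota (qa H) != 0 by rewrite fmorph_eq0 qa_neq0.
have b0 : iota (qb H) != 0 by rewrite fmorph_eq0 qb_neq0.
have ti : \tr (phi (qi H)) = 0.
  apply: (@anticommute_mxtrace _ (phi (qj H)) _ b0); first by rewrite -rmorphM JJ phi_scalar.
  by rewrite -!rmorphM JI rmorphN opprK.
have tj : \tr (phi (qj H)) = 0.
  apply: (@anticommute_mxtrace _ (phi (qi H)) _ a0); first by rewrite -rmorphM II phi_scalar.
  by rewrite -!rmorphM JI rmorphN.
have tij : \tr (phi (qi H * qj H)) = 0.
  apply: (@anticommute_mxtrace _ (phi (qi H)) _ a0); first by rewrite -rmorphM II phi_scalar.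
  by rewrite -!rmorphM -[qi H * qj H * qi H]mulrA JI mulrN rmorphN.
rewrite {1}[x]quaternionE !rmorphD !phiZ !raddfD /= !mxtraceZ ti tj tij !mulr0 !addr0.
by rewrite rmorph1 mxtrace1 mulrC /trd rmorphM rmorph_nat.
Qed.

(** The conjugate of [x] is sent to the adjugate of the image of [x]. *)
Lemma det_phi x : \det (phi x) = iota (nrd H x).
Proof.
have := congr1 phi (mul_conjq x).
rewrite rmorphM rmorphB !phi_scalar -mxtrace_phi => /matrixP/(_ 0 0).
rewrite -[phi x * _]/(phi x *m _) mulmx22 !mxE /= !mulr1n !mulr0n => <-.
rewrite /mxtrace !big_ord_recl big_ord0 det22.
have -> : lift ord0 ord0 = 1 :> 'I_2 by apply: val_inj.
by rewrite -[ord0]/(0 : 'I_2); ring.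
Qed.

Lemma nrd_mul x y : nrd H (x * y) = nrd H x * nrd H y.
Proof.
by apply: (fmorph_inj iota); rewrite rmorphM -!det_phi rmorphM -mulmxE det_mulmx.
Qed.

End Matrices.

(** If [x] is not a scalar then its characteristic polynomial [X^2 - trd x X + nrd x]
    divides every polynomial that vanishes at [x], in particular the one given by
    [multiplier_integral]. *)
Lemma multiplier_trd_nrd (N : set A) x : lattice N -> (forall y, N y -> N (x * y)) ->
  ZK (trd x) /\ ZK (nrd H x).
Proof.
move=> Nlat xN; have [chi [mon_chi Zchi chix]] := multiplier_integral Nlat xN.
have [[s xs]|nscal] := pselect (exists s, x = s%:A).
  have Zs : ZK s.
    apply: (@integral_root_monic _ _ intr s chi mon_chi); last exact/integral_poly.
    apply/rootP/(fmorph_inj (in_alg A)); rewrite rmorph0 -chix xs.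
    exact: (esym (horner_map (in_alg A) chi s)).
  rewrite xs trd_scalar nrd_scalar; split; last exact: ZKX.
  by apply: ZKM => //; apply: (ZKint _ 2%:R).
apply: (@quadratic_factor_integral _ chi) => //.
set f := _ + _; have fx : horner_alg x f = 0.
  rewrite /f -mul_polyC rmorphD rmorphB rmorphXn rmorphM /= !horner_algX !horner_algC.
  by rewrite -mul_conjq /conjq mulrBr mulr_algr mulr_algl addrC addrA subrK subrr.
have size_f : size f = 3 by apply: size_quadratic.
rewrite /dvdp; set r := chi %% f.
have rE : r = (r`_1)%:P * 'X + (r`_0)%:P.
  have : (size r <= 2)%N by have := ltn_modp chi f; rewrite -size_poly_eq0 size_f.
  move=> r2; apply/polyP => -[|[|k]]; rewrite coefD coefMX !coefC ?add0r ?addr0 //=.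
  by rewrite nth_default //; apply: leq_trans r2 _.
have : horner_alg x r = 0.
  have := congr1 (horner_alg x) (divp_eq chi f).
  by rewrite chix rmorphD rmorphM /= fx mulr0 add0r.
rewrite rE rmorphD rmorphM /= horner_algX !horner_algC mulr_algl.
have [->|r1] := eqVneq r`_1 0.
  rewrite scale0r add0r => /eqP; rewrite scaler_eq0 oner_eq0 orbF => /eqP->.
  by rewrite polyC0 mul0r addr0.
move/(canRL (addrK _)); rewrite sub0r => /(congr1 ( *:%R (r`_1)^-1)).
rewrite scalerA mulVf // scale1r => xE; case: nscal.
by exists (- ((r`_1)^-1 * r`_0)); rewrite xE scalerN scalerA scaleNr.
Qed.

(** The conjugate is the difference of the trace, which is integral, and of the
    element itself. *)
Lemma order_conjq (O : set A) x : Defs.order O -> O x -> O (conjq x).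
Proof.
move=> [Olat O1 OM] Ox; have [Zt _] := multiplier_trd_nrd Olat (fun y => OM x y Ox).
have [[n [e OE]] _] := Olat; have [_ OD OZ] : ZKmod O by rewrite OE; apply: span_ZK.
apply: OD; first exact: OZ.
by rewrite -scaleN1r; apply: OZ => //; apply/ZKN/ZK1.
Qed.

End Quaternion.

(** * Localization and completion of an order *)

Section LocalOrder.
Variables (K : fieldExtType rat) (A : falgType K).
Variables (p : set K) (p_prime : prime_ideal p) (Kp : completion p).
Variables (phi : {rmorphism A -> 'M[Kp]_2}) (p_split : splitting (cemb Kp) phi).
Local Notation ZK := (@ringOfIntegers K).
Local Notation vge n x := (@val_ge K p Kp n (cemb Kp x)).
Local Notation v := (@cval K p Kp).

Lemma phiZ a x : phi (a *: x) = cemb Kp a *: phi x. Proof. by case: p_split. Qed.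

Lemma lattice_ZKmod (I : set A) : lattice I -> ZKmod I.
Proof. by move=> [[n [e ->]] _]; apply: span_ZK. Qed.

Section Denominators.
Variables (O : set A) (O_lat : lattice O).

Definition localization : set A := [set y | exists s, [/\ ZK s, ~ p s & O (s *: y)]].

Lemma localizationD x y : localization x -> localization y -> localization (x + y).
Proof.
have [_ OD OZ] := lattice_ZKmod O_lat; have [_ _ _ pM] := p_prime.
move=> [s [Zs ps sx]] [t [Zt pt ty]]; exists (s * t); split; first exact: ZKM.
  by move/(pM _ _ Zs Zt) => -[].
have -> : (s * t) *: (x + y) = t *: (s *: x) + s *: (t *: y).
  by rewrite scalerDr !scalerA [t * s]mulrC.
by apply: OD; apply: OZ.
Qed.

Lemma localizationZ k x : vge 0 k -> localization x -> localization (k *: x).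
Proof.
have [_ OD OZ] := lattice_ZKmod O_lat; have [_ _ _ pM] := p_prime.
move=> /(vge0_denom p_prime)[t [Zt pt tk]] [s [Zs ps sx]].
exists (t * s); split; first exact: ZKM.
  by move/(pM _ _ Zt Zs) => -[].
by rewrite scalerA -mulrA [s * k]mulrC mulrA -scalerA; apply: OZ.
Qed.

Lemma sub_localization x : O x -> localization x.
Proof.
by move=> Ox; exists 1; rewrite scale1r; split=> //; [exact: ZK1 | case: p_prime].
Qed.

(** The lattice spans the algebra over the number field: expand [x] on elements of
    [O] and absorb the denominators. *)
Lemma localization_denom x : exists N : nat, forall c, vge N c -> localization (c *: x).
Proof.
have : span_mul setT O x by case: O_lat => _ ->.
move: x; apply: (@span_mul_ind _ _ _ _
  [set x | exists N : nat, forall c, vge N c -> localization (c *: x)]) => /= [|x y|k x _ Ox].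
- exists 0%N => c _; rewrite scaler0; apply: sub_localization.
  by case: (lattice_ZKmod O_lat).
- move=> [N HN] [M HM]; exists (N + M)%N => c vc; rewrite scalerDr.
  by apply: localizationD; [apply: HN | apply: HM]; apply: val_geW vc; lia.
have [N vk] := @val_ge_fin _ _ Kp unit (fun=> cemb Kp k).
exists N => c vc; rewrite scalerA; apply: localizationZ; last exact: sub_localization.
by rewrite -(subrr N%:Z); apply: vK_M => //; apply: (vk tt).
Qed.

(** By density, approximate the coefficients of [z] in the completed valuation
    ring by elements of the number field, which are then integral at [p]. *)
Lemma local_lattice_approx z (M : int) : local_lattice phi O z ->
  exists2 x, localization x & forall i j, val_ge M ((z - phi x) i j).
Proof.
move: z; apply: (@span_mul_ind _ _ _ _
  [set z | exists2 x, localization x & forall i j, val_ge M ((z - phi x) i j)]) => /=.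
- exists 0; first by apply: sub_localization; case: (lattice_ZKmod O_lat).
  by move=> i j; rewrite rmorph0 subr0 mxE; left.
- move=> y z [x Lx Hx] [x' Lx' Hx']; exists (x + x'); first exact: localizationD.
  by move=> i j; rewrite rmorphD opprD addrACA mxE; apply: val_geD.
move=> r _ r_int [x Ox <-].
have [N vN] := @val_ge_fin _ _ Kp ('I_2 * 'I_2)%type (fun ij => phi x ij.1 ij.2).
have [k rk] := cdense r (`|M| + N)%:Z.
exists (k *: x).
  apply: localizationZ; last exact: sub_localization.
  rewrite -(subKr r (cemb Kp k)); apply: val_geB => //.
  by apply: val_geW rk; lia.
move=> i j; rewrite phiZ -scalerBl mxE.
apply: (@val_geW _ _ _ ((`|M| + N)%:Z + - N%:Z)); first lia.
by apply: val_geM => //; apply: (vN (i, j)).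
Qed.

(** A basis of the algebra is sent to a basis of the matrices, and the coordinates
    on the latter are linear functions of the entries. *)
Lemma coord_bound : exists C : nat, forall y (M : int),
  (forall i j, val_ge M (phi y i j)) ->
  forall k, vge (M - C%:Z) (coord (vbasis {:A}) k y).
Proof.
have [_ phi_basis] := p_split.
pose b : (\dim {:A}).-tuple 'M[Kp]_2 := [tuple of [seq phi x | x <- vbasis {:A}]].
have b_free : free b by apply: basis_free phi_basis.
have [C HC] := @val_ge_fin _ _ Kp ('I_(\dim {:A}) * ('I_2 * 'I_2))%type
  (fun t => coord b t.1 (delta_mx t.2.1 t.2.2)).
exists C => y M yM k.
have -> : cemb Kp (coord (vbasis {:A}) k y) = coord b k (phi y).
  rewrite {2}(coord_vbasis (memvf y)) rmorph_sum /=.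
  under eq_bigr => j _ do rewrite phiZ.
  rewrite -[RHS](_ : coord b k (\sum_j cemb Kp (coord (vbasis {:A}) j y) *: b`_j) = _).
    by rewrite coord_sum_free.
  congr (coord b k _); apply: eq_bigr => j _.
  by rewrite (nth_map 0) // size_tuple.
rewrite [X in coord b k X]matrix_sum_delta linear_sum; apply: val_ge_sum => i _.
rewrite linear_sum; apply: val_ge_sum => j _; rewrite linearZ /=.
by apply: val_geM => //; apply: (HC (k, (i, j))).
Qed.

(** The inclusion of the completion of [O], intersected with the algebra, in the
    localization of [O]: approximate [y] by elements of the localization; the
    error is small in a basis of the algebra, so it has no denominator at [p]. *)
Lemma local_lattice_denom y : local_lattice phi O (phi y) -> localization y.
Proof.
move=> Oy; have [C HC] := coord_bound.
have /choice[N HN] k := localization_denom (vbasis {:A})`_k.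
(* Precise enough for every coordinate of the error to be absorbed. *)
pose M := (\sum_(k < \dim {:A}) N k + C)%N.
have [x Lx yx] := local_lattice_approx M%:Z Oy.
rewrite -[y](subrK x); apply: localizationD => //.
rewrite [y - x](coord_vbasis (memvf _)).
apply: (big_ind localization) => [|z z'|k _].
- by apply: sub_localization; case: (lattice_ZKmod O_lat).
- exact: localizationD.
apply: HN; apply: val_geW (HC _ M%:Z _ k); last by rewrite rmorphB.
by rewrite /M PoszD addrK lez_nat (bigD1 k) //= leq_addr.
Qed.

(** A denominator prime to [p] and a denominator that is a power of [p] cancel, by
    [pow_coprime]. In this way inclusions in [O] are checked at [p] alone. *)
Lemma localization_descent (m : nat) y :
  (forall q, pow_ideal p m q -> O (q *: y)) -> localization y -> O y.
Proof.
have [_ OD OZ] := lattice_ZKmod O_lat.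
move=> my [s [Zs ps sy]]; have [a [q [Za mq E]]] := pow_coprime p_prime m Zs ps.
rewrite -[y]scale1r E scalerDl; apply: OD; last exact: my.
by rewrite mulrC -scalerA; apply: OZ.
Qed.

End Denominators.

Section FixedPoint.
Variables (O : set A) (O_order : Defs.order O) (E : 'M[Kp]_2) (Eu : E \in unitmx).
Local Notation Op := (local_lattice phi O).

Let conjE (m : 'M[Kp]_2) := invmx E *m m *m E.

Let conjEM m n : conjE (m *m n) = conjE m *m conjE n.
Proof. by rewrite /conjE -!mulmxA mulKVmx. Qed.

Let conjEK m : conjE (E *m m *m invmx E) = m.
Proof. by rewrite /conjE !mulmxA mulVmx // mul1mx -mulmxA mulVmx // mulmx1. Qed.

Let conjKE m : E *m conjE m *m invmx E = m.
Proof. by rewrite /conjE !mulmxA mulmxV // mul1mx -mulmxA mulmxV // mulmx1. Qed.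

Lemma localM m n : Op m -> Op n -> Op (m *m n).
Proof.
have [_ _ OM] := O_order; move=> mO nO; move: m mO.
apply: (@span_mul_ind _ _ _ _ [set m | Op (m *m n)]) => [|m m'|r _ r_int [x Ox <-]] /=.
- by rewrite mul0mx; apply: span_mul0.
- by move=> ? ?; rewrite mulmxDl; apply: span_mulD.
move: n nO.
apply: (@span_mul_ind _ _ _ _ [set n | Op (r *: phi x *m n)]) => [|m m'|s _ s_int [y Oy <-]] /=.
- by rewrite mulmx0; apply: span_mul0.
- by move=> ? ?; rewrite mulmxDr; apply: span_mulD.
rewrite -scalemxAl -scalemxAr scalerA mulmxE -rmorphM; apply: span_mul_gen.
  by have := val_geM r_int s_int; rewrite addr0.
by exists (x * y) => //; apply: OM.
Qed.

Lemma localZ c m : val_ge 0 c -> Op m -> Op (c *: m).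
Proof.
by move=> c_int; apply: span_mulZ => r /(val_geM c_int); rewrite addr0.
Qed.

Lemma local1 : Op 1%:M.
Proof.
have [_ O1 _] := O_order; rewrite -[1%:M]scale1r; apply: span_mul_gen.
  exact: val_ge1.
by exists 1; rewrite // rmorph1.
Qed.

Lemma localX m k : Op m -> Op (m ^+ k).
Proof.
move=> Om; elim: k => [|k IHk]; first exact: local1.
by rewrite exprS -mulmxE; apply: localM.
Qed.

Lemma local_bounded : exists N : nat, forall m, Op m ->
  forall i j, val_ge (- N%:Z) (conjE m i j).
Proof.
have [[[n [e OE]] _] _ _] := O_order.
have [N HN] := @val_ge_fin _ _ Kp ('I_n * ('I_2 * 'I_2))%type
  (fun t => conjE (phi (e t.1)) t.2.1 t.2.2).
exists N; apply: span_mul_ind => [|m m' mN m'N i j|r _ r_int [x + <-]].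
- by move=> i j; left; rewrite /conjE mulmx0 mul0mx mxE.
- by rewrite /conjE mulmxDr mulmxDl mxE; apply: val_geD.
move=> Ox i j; rewrite /conjE -scalemxAr -scalemxAl mxE -[- _]add0r.
apply: val_geM => //; rewrite -/(conjE _); move: x Ox i j; rewrite OE.
apply: span_mul_ind => [|x y xN yN|s _ /(vge_ZK Kp) s_int [k _ <-]] i j.
- by left; rewrite rmorph0 /conjE mulmx0 mul0mx mxE.
- by rewrite rmorphD /conjE mulmxDr mulmxDl mxE; apply: val_geD.
rewrite phiZ /conjE -scalemxAr -scalemxAl mxE -[- _]add0r.
by apply: val_geM => //; apply: (HN (k, (i, j))).
Qed.

(** The powers of [m] are bounded because they stay in the completion of [O], so
    the powers of the determinant are bounded. *)
Lemma local_det m : Op m -> val_ge 0 (\det m).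
Proof.
move=> Om; have [N HN] := local_bounded.
apply: (@val_ge0_pow _ _ _ _ (- (N + N)%:Z)) => k.
have -> : \det m ^+ k = \det (conjE (m ^+ k)).
  rewrite /conjE !det_mulmx det_inv mulrC mulrA divff ?mul1r; last first.
    by rewrite -unitfE -unitmxE.
  elim: k => [|k IHk]; first by rewrite !expr0 det1.
  by rewrite !exprS -mulmxE det_mulmx IHk.
by apply: vge_det (HN _ (localX k Om)) _; lia.
Qed.

(** The completion of an order whose unit group fixes the vertex of [E] is the
    full endomorphism ring of the lattice of [E]. It contains the automorphisms
    of this lattice: they fix the vertex, so they are scalar multiples of units of
    the order, and the scalar is a unit by comparison of determinants.
    Automorphisms generate all endomorphisms. Conversely a nonintegral entry of
    an element of the completion would give an element with unbounded powers. *)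
Lemma fixed_point_local : fixed_point phi O (vertex_of E) ->
  forall m, Op m <-> integral_mx (invmx E *m m *m E).
Proof.
move=> [_ stab]; have unitsO U : integral_GL U -> Op (E *m U *m invmx E).
  move=> GU; set m := _ *m invmx E; have mu : m \in unitmx.
    by rewrite !unitmx_mul unitmx_inv Eu integral_GL_unit.
  have [stab_m _] := stab m mu.
  have [|c [u [c0 uu Ou Ou' mE]]] := stab_m.
    by rewrite actM_vertex_of /m mulmxKV // vertex_ofM.
  have u0 : \det u != 0 by rewrite -unitfE -unitmxE.
  have vu : v (\det u) = 0.
    have := val_ge_unit u0 (local_det Ou); have := local_det Ou'.
    move/val_ge_unit; rewrite det_inv invr_eq0 cvalV // => /(_ u0).
    by set d := v _; lia.
  have [_ U0 vU] := GU; have : v (\det m) = 0.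
    have E0 : \det E != 0 by rewrite -unitfE -unitmxE.
    rewrite /m !det_mulmx det_inv !cvalM ?mulf_neq0 ?invr_eq0 // cvalV // vU.
    by set d := v _; lia.
  rewrite mE detZ expr2 !cvalM ?mulf_neq0 // vu => vc.
  by apply: localZ => //; right; move: vc; set d := v c; lia.
(* Off the diagonal, a matrix unit is the difference of two automorphisms; on the
   diagonal it is a product of two matrix units off the diagonal. *)
have deltaO i j : Op (E *m delta_mx i j *m invmx E).
  have offdiag k l : k != l -> Op (E *m delta_mx k l *m invmx E).
    move=> kl; have -> : delta_mx k l = (1%:M + delta_mx k l) - 1%:M :> 'M[Kp]_2.
      by rewrite addrAC subrr add0r.
    rewrite mulmxBr mulmxBl; apply: span_mulD; last first.
      by rewrite -scaleN1r; apply: localZ; [right; rewrite cvalN1 | apply/unitsO/integral_GL1].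
    apply: unitsO; have det1D : \det (1%:M + delta_mx k l : 'M[Kp]_2) = 1.
      rewrite det22 !mxE; case: k kl => [[|[|]]] //= ?; case: l => [[|[|]]] //= ? _;
        rewrite -?val_eqE /=; ring.
    split; rewrite ?det1D ?oner_neq0 ?cval1 //.
    by apply: integral_mx_add; [apply: integral_mx1 | apply: integral_mx_delta].
  have [->|ij] := eqVneq i j; last exact: offdiag.
  have [j' jj'] : exists j' : 'I_2, j != j'.
    by exists (if j == 0 then 1 else 0); case: (j) => [[|[|]]].
  have -> : delta_mx j j = delta_mx j j' *m delta_mx j' j :> 'M[Kp]_2.
    by rewrite mul_delta_mx.
  have := localM (offdiag j j' jj') (offdiag j' j _).
  by rewrite !mulmxA mulmxKV //; apply; rewrite eq_sym.
move=> m; split=> [Om i j|]; last first.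
  move=> mi; rewrite -[m]conjKE [conjE m]matrix_sum_delta.
  rewrite mulmx_sumr mulmx_suml; apply: (big_ind Op) => [||i _].
  - exact: span_mul0.
  - exact: span_mulD.
  rewrite mulmx_sumr mulmx_suml; apply: (big_ind Op) => [||j _].
  - exact: span_mul0.
  - exact: span_mulD.
  by rewrite -scalemxAr -scalemxAl; apply: localZ => //; apply: mi.
have [N HN] := local_bounded.
apply: (@val_ge0_pow _ _ _ _ (- N%:Z)) => k.
(* Matrix units move the entry to the corner, where it is raised to powers. *)
pose e := E *m delta_mx 0 i *m invmx E *m m *m (E *m delta_mx j 0 *m invmx E).
have Oe : Op e by apply: localM => //; apply: localM.
suff -> : (invmx E *m m *m E) i j ^+ k = conjE (e ^+ k) 0 0 by apply/HN/localX.
have eE : conjE e = conjE m i j *: delta_mx 0 0.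
  rewrite /e conjEM conjEM !conjEK; move: (conjE m) => Y.
  by have [->|->] := ord2 i; have [->|->] := ord2 j; apply: matrix22P;
    rewrite !mulmx22 !mxE /=; ring.
have -> : conjE (e ^+ k) = (conjE e) ^+ k.
  elim: k => [|k IHk]; first by rewrite !expr0 /conjE mulmx1 mulVmx.
  by rewrite !exprS -!mulmxE conjEM IHk.
rewrite eE -/(conjE m); move: (conjE m i j) => c; elim: k => [|k IHk]; first by rewrite !expr0 mxE.
by rewrite !exprS -mulmxE mulmx22 -IHk !mxE /=; ring.
Qed.

End FixedPoint.
End LocalOrder.

(** * Left translates and prime multiples of lattices *)

Section LatticeOperations.
Variables (K : fieldExtType rat) (A : falgType K).
Variables (p : set K) (p_prime : prime_ideal p) (Kp : completion p).
Local Notation ZK := (@ringOfIntegers K).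
Local Notation pow n := (pow_ideal p n).
Implicit Types (J : set A).

(** Induction on [r], peeling off one factor of [p] at a time from [t]. *)
Lemma pow_mulN_mem (r m : nat) t u : pow (r + m)%N t -> pow (- m%:Z) u -> pow r (u * t).
Proof.
move=> + mu; elim: r t => [|r IHr] t; first by move: t; apply/powN_mem.
rewrite addSn; move: t.
apply: (@span_mul_ind K K^o _ _ [set t | pow r.+1 (u * t)]) => [|x y|q t pq /IHr rt] /=.
- by rewrite mulr0; apply: span_mul0.
- by rewrite mulrDr; apply: span_mulD.
by rewrite mulrCA; apply: (@span_mul_gen K K^o).
Qed.

Lemma powN1 (m : nat) : pow (- m%:Z) 1.
Proof. by apply/powN_mem => y; rewrite mul1r; apply: pow_ZK. Qed.

(** The invertibility of [p ^ m], in the form used for the two places where the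
    algorithm trades a factor of [J] against the exponent [r]. *)
Lemma pow_span_cancel (r m : nat) J :
  span_mul (pow (r + m)%N) (span_mul (pow (- m%:Z)) J) = span_mul (pow r) J.
Proof.
apply/seteqP; split.
  apply: span_mul_ind => [|x y|t x rt]; [exact: span_mul0 | exact: span_mulD|].
  move: x; apply: (@span_mul_ind _ _ _ _ [set x | span_mul (pow r) J (t *: x)])
    => [|x y|u x mu Jx] /=.
  - by rewrite scaler0; apply: span_mul0.
  - by rewrite scalerDr; apply: span_mulD.
  by rewrite scalerA mulrC; apply: span_mul_gen => //; apply: pow_mulN_mem rt mu.
apply: span_mul_ind => [|x y|t x rt Jx]; [exact: span_mul0 | exact: span_mulD|].
have [n [a [b [ma mb E]]]] := pow_mulN p_prime Kp m.
have -> : t *: x = \sum_i (t * a i) *: (b i *: x).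
  rewrite -[LHS]scale1r E scaler_suml; apply: eq_bigr => i _.
  by rewrite !scalerA; congr (_ *: _); ring.
apply: span_mul_sum => i; first exact: pow_M.
exact: span_mul_gen.
Qed.

Lemma pow_span_cancel0 (m : nat) J : lattice J ->
  span_mul (pow m) (span_mul (pow (- m%:Z)) J) = J.
Proof.
by move=> /lattice_ZKmod J_mod; rewrite -[m]add0n pow_span_cancel; apply: span_ZK_id.
Qed.

Lemma sub_pow_span (m : nat) J : J `<=` span_mul (pow (- m%:Z)) J.
Proof. by move=> x Jx; rewrite -[x]scale1r; apply: span_mul_gen => //; apply: powN1. Qed.

Lemma fg_finType (T : finType) (e : T -> A) :
  exists n (f : 'I_n -> A), span_mul ZK (range e) = span_mul ZK (range f).
Proof.
exists #|T|, (fun i => e (enum_val i)); congr span_mul.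
apply/seteqP; split=> [_ [t _ <-]|_ [i _ <-]]; last by exists (enum_val i).
by exists (enum_rank t); rewrite ?enum_rankK.
Qed.

(** The elements [b i] of [pow_mulN] generate [p ^ -m], so their products with
    generators of [J] generate [p ^ -m J]. *)
Lemma lattice_pow (m : nat) J : lattice J -> lattice (span_mul (pow (- m%:Z)) J).
Proof.
move=> [[k [e JE]] Jspan]; split; last first.
  by apply/seteqP; split=> // x _;
    apply: (span_mul_sub (fun s (h : setT s) => h) (@sub_pow_span m J));
    rewrite Jspan.
have [n [a [b [ma mb E]]]] := pow_mulN p_prime Kp m.
have [N [f fE]] := fg_finType (fun ij : 'I_n * 'I_k => b ij.1 *: e ij.2).
exists N, f; rewrite -fE; apply/seteqP; split.
  apply: span_mul_ind => [|x y|t x mt]; [exact: span_mul0 | exact: span_mulD|].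
  rewrite JE => /span_mul_range[||s Zs ->]; [exact: ZK0 | exact: ZKD|].
  have -> : t *: \sum_j s j *: e j =
      \sum_(ij : 'I_n * 'I_k) (t * a ij.1 * s ij.2) *: (b ij.1 *: e ij.2).
    rewrite -(pair_bigA _ (fun i j => (t * a i * s j) *: (b i *: e j))) exchange_big /=.
    rewrite scaler_sumr; apply: eq_bigr => j _.
    rewrite -[LHS]scale1r E scaler_suml; apply: eq_bigr => i _.
    by rewrite !scalerA; congr (_ *: _); ring.
  apply: span_mul_sum => ij; last by exists ij.
  by apply: ZKM => //; move/powN_mem: mt; apply.
apply: span_mul_ind => [|x y|s _ Zs [ij _ <-]]; [exact: span_mul0 | exact: span_mulD|].
rewrite scalerA; apply: span_mul_gen; first by case: (pow_ZKmod p_prime (- m%:Z)) => _ _; apply.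
rewrite JE -[e _]scale1r; apply: span_mul_gen; [exact: ZK1 | by exists ij.2].
Qed.

Lemma right_order_pow (m : nat) J : lattice J ->
  right_order (span_mul (pow (- m%:Z)) J) = right_order J.
Proof.
move=> J_lat; apply/seteqP; split=> x xJ y; last first.
  move: y; apply: (@span_mul_ind _ _ _ _ [set y | span_mul (pow (- m%:Z)) J (y * x)])
    => [|y z|t y mt Jy] /=.
  - by rewrite mul0r; apply: span_mul0.
  - by rewrite mulrDl; apply: span_mulD.
  by rewrite -scalerAl; apply: span_mul_gen => //; apply: xJ.
rewrite -[J in J y](pow_span_cancel0 m J_lat) -[J in J (y * x)](pow_span_cancel0 m J_lat).
move: y; apply: (@span_mul_ind _ _ _ _
  [set y | span_mul (pow m) (span_mul (pow (- m%:Z)) J) (y * x)]) => [|y z|t y mt Jy] /=.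
- by rewrite mul0r; apply: span_mul0.
- by rewrite mulrDl; apply: span_mulD.
by rewrite -scalerAl; apply: span_mul_gen => //; apply: xJ.
Qed.

Lemma lmul_span (a : set K) g J : lmul_set g (span_mul a J) = span_mul a (lmul_set g J).
Proof.
apply/seteqP; split=> [_ [x ax <-]|].
  move: x ax; apply: (@span_mul_ind _ _ _ _ [set x | span_mul a (lmul_set g J) (g * x)])
    => [|x y|s x As Jx] /=.
  - by rewrite mulr0; apply: span_mul0.
  - by rewrite mulrDr; apply: span_mulD.
  by rewrite -scalerAr; apply: span_mul_gen => //; exists x.
apply: span_mul_ind => [|_ _ [x ax <-] [y ay <-]|s _ As [x Jx <-]].
- by exists 0; rewrite ?mulr0 //; apply: span_mul0.
- by exists (x + y); rewrite ?mulrDr //; apply: span_mulD.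
by exists (s *: x); rewrite ?scalerAr //; apply: span_mul_gen.
Qed.

Lemma lmul_comp g h J : lmul_set g (lmul_set h J) = lmul_set (g * h) J.
Proof.
apply/seteqP; split=> [_ [_ [x Jx <-] <-]|_ [x Jx <-]].
  by exists x; rewrite ?mulrA.
by exists (h * x); [exists x | rewrite mulrA].
Qed.

Lemma lmul1 J : lmul_set 1 J = J.
Proof.
apply/seteqP; split=> [_ [x Jx <-]|x Jx]; first by rewrite mul1r.
by exists x; rewrite ?mul1r.
Qed.

Lemma lattice_lmul g J : g \is a GRing.unit -> lattice J -> lattice (lmul_set g J).
Proof.
move=> gu [[k [e JE]] Jspan]; split; last first.
  rewrite -lmul_span Jspan; apply/seteqP; split=> // x _.
  by exists (g^-1 * x) => //; rewrite mulVKr.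
exists k, (fun i => g * e i); rewrite JE lmul_span; congr span_mul.
apply/seteqP; split=> [_ [_ [i _ <-] <-]|_ [i _ <-]]; first by exists i.
by exists (e i) => //; exists i.
Qed.

Lemma right_order_lmul g J : g \is a GRing.unit -> right_order (lmul_set g J) = right_order J.
Proof.
move=> gu; apply/seteqP; split=> x xJ y.
  move=> Jy; have [|z Jz] := xJ (g * y); first by exists y.
  by rewrite -mulrA => /(mulrI gu) <-.
by move=> [z Jz <-]; exists (z * x); [apply: xJ | rewrite mulrA].
Qed.

End LatticeOperations.

(** * The reduction loop *)

Section Reduction.
Variables (K : fieldExtType rat) (A : falgType K) (H : quaternion_algebra A).
Variables (O : set A) (O_order : Defs.order O).
Variables (p : set K) (p_prime : prime_ideal p) (Kp : completion p).
Variables (phi : {rmorphism A -> 'M[Kp]_2}) (p_split : splitting (cemb Kp) phi).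
Local Notation ZK := (@ringOfIntegers K).
Local Notation pow n := (pow_ideal p n).
Local Notation vge n x := (@val_ge K p Kp n (cemb Kp x)).
Local Notation v x := (@cval K p Kp (cemb Kp x)).
Local Notation pi := (cunif Kp).
Local Notation nrd := (nrd H).

Let O_lat : lattice O. Proof. by case: O_order. Qed.
Let OM x y : O x -> O y -> O (x * y). Proof. by case: O_order => _ _; exact. Qed.
Let phiZ a x : phi (a *: x) = cemb Kp a *: phi x. Proof. exact: phiZ. Qed.
Let det_phi x : \det (phi x) = cemb Kp (nrd x). Proof. exact: det_phi. Qed.
Let nrdM x y : nrd (x * y) = nrd x * nrd y. Proof. exact: nrd_mul phiZ x y. Qed.
Let emb_neq0 (x : K) : (cemb Kp x != 0) = (x != 0). Proof. by rewrite fmorph_eq0. Qed.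

Lemma nrd1 : nrd 1 = 1.
Proof. by have := nrd_scalar H 1; rewrite scale1r expr1n. Qed.

Lemma ZK_nrd (N : set A) x : lattice N -> left_order N x -> ZK (nrd x).
Proof. by move=> N_lat xN; case: (multiplier_trd_nrd H N_lat xN). Qed.

Lemma ZK_nrd_order x : O x -> ZK (nrd x).
Proof. by move=> Ox; apply: (ZK_nrd O_lat) => y; apply: OM. Qed.

(** The norms of [g] and of its inverse are both integral, and their product is 1. *)
Lemma v_nrd_unit (N : set A) g : lattice N -> g \is a GRing.unit ->
  left_order N g -> left_order N g^-1 -> nrd g != 0 /\ v (nrd g) = 0.
Proof.
move=> N_lat gu /(ZK_nrd N_lat)/(vge_ZK Kp) vg /(ZK_nrd N_lat)/(vge_ZK Kp) vg'.
have E : nrd g * nrd g^-1 = 1 by rewrite -nrdM mulrV // nrd1.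
have g0 : nrd g != 0 by apply: contra_eq_neq E => ->; rewrite mul0r eq_sym oner_eq0.
have g0' : nrd g^-1 != 0 by apply: contra_eq_neq E => ->; rewrite mulr0 eq_sym oner_eq0.
split=> //; have := vge_v g0' vg'; have := vge_v g0 vg.
have : v (nrd g) + v (nrd g^-1) = 0 by rewrite -vK_eqM // E rmorph1 cval1.
by set a := v (nrd g); set b := v _; lia.
Qed.

(** For [n] in [N], the norm of [n] is the product of [n] and its conjugate; the left
    order sends [n] into [O], which contains the conjugate. So the left
    order of an ideal of norm [p] differs from [O] by a denominator [p] only. *)
Lemma conductor_left_order (N : set A) q y : integral_right_ideal O N ->
  nrd_ideal H N = p -> p q -> left_order N y -> O (q *: y).
Proof.
move=> [N_lat _ NO] <- + yN; have [O0 OD OZ] := lattice_ZKmod O_lat.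
move: q; apply: (@span_mul_ind K K^o _ _ [set q | O (q *: y)]) => [|q r|s _ Zs [n Nn <-]] /=.
- by rewrite scale0r.
- by move=> Oq Or; rewrite scalerDl; apply: OD.
change (O ((s * nrd n) *: y)); rewrite -scalerA; apply: OZ => //.
rewrite -mulr_algr -mul_conjq mulrA; apply: OM; first exact/NO/yN.
by apply: (order_conjq H O_order); apply: NO.
Qed.

Section Fixed.
Variables (E : 'M[Kp]_2) (Eu : E \in unitmx) (E_fixed : fixed_point phi O (vertex_of E)).

(** The matrix of [x] on the lattice of [E], through which the completion of [O]
    becomes the ring of integral matrices. *)
Definition coords (x : A) : 'M[Kp]_2 := invmx E *m phi x *m E.

Lemma coordsM x y : coords (x * y) = coords x *m coords y.
Proof. by rewrite /coords rmorphM -mulmxE -!mulmxA mulKVmx. Qed.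

Lemma coordsZ a x : coords (a *: x) = cemb Kp a *: coords x.
Proof. by rewrite /coords phiZ -scalemxAr -scalemxAl. Qed.

Lemma det_coords x : \det (coords x) = cemb Kp (nrd x).
Proof.
have E0 : \det E != 0 by rewrite -unitfE -unitmxE.
by rewrite /coords !det_mulmx det_inv mulrC mulrA divff // mul1r det_phi.
Qed.

Lemma act_coords x : act phi x (vertex_of E) = vertex_of (E *m coords x).
Proof. by rewrite /act actM_vertex_of /coords !mulmxA mulmxV // mul1mx. Qed.

Lemma localP x : local_lattice phi O (phi x) <-> integral_mx (coords x).
Proof. exact: fixed_point_local. Qed.

Lemma int_coords x : O x -> integral_mx (coords x).
Proof.
move=> Ox; apply/localP; rewrite -[phi x]scale1r; apply: span_mul_gen; first exact: val_ge1.
by exists x.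
Qed.

(** [x] is a generator of the right [O]-lattice [J] locally at [p]. Only one of the two
    local inclusions is recorded, the other one being a consequence of [J x]. *)
Definition generated (J : set A) (x : A) : Prop :=
  [/\ lattice J, right_order J = O, J x, nrd x != 0 &
      forall y, J y -> integral_mx (coords (x^-1 * y))].

Lemma generated_lmul g J x : nrd g != 0 -> generated J x -> generated (lmul_set g J) (g * x).
Proof.
move=> g0 [J_lat JO Jx x0 xJ]; have gu := nrd_unit g0.
have xu := nrd_unit x0; split.
- exact: lattice_lmul.
- by rewrite right_order_lmul.
- by exists x.
- by rewrite nrdM mulf_neq0.
by move=> _ [y Jy <-]; rewrite invrM // -mulrA mulKr //; apply: xJ.
Qed.

(** Locally an element of [J] is [x] times an integral matrix, whose determinant is
    integral. *)
Lemma vge_nrd_ideal J x : generated J x ->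
  forall a, nrd_ideal H J a -> vge (v (nrd x)) a.
Proof.
move=> [_ _ _ x0 xJ]; apply: (@span_mul_ind K K^o _ _ [set a | vge (v (nrd x)) a]).
- by left; rewrite rmorph0.
- by move=> a b; apply: vK_D.
move=> s _ /(vge_ZK Kp) vs [y Jy <-]; rewrite -[v _]add0r; apply: vK_M => //.
rewrite -[y](mulVKr (nrd_unit x0)) nrdM -[v _]addr0; apply: vK_M; first by right.
by rewrite -det_coords; apply/integral_mx_det/xJ.
Qed.

Lemma nrd_generator J x : generated J x -> nrd_ideal H J (nrd x).
Proof.
move=> [_ _ Jx _ _]; rewrite -[nrd x]mul1r; apply: (@span_mul_gen K K^o); first exact: ZK1.
by exists x.
Qed.

(** The norm of a local generator has the least valuation among the norms of the
    elements of the ideal. *)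
Lemma val_nrd_ideal J x (n : nat) : generated J x -> J `<=` O -> v (nrd x) = n ->
  val_ideal p (nrd_ideal H J) n.
Proof.
move=> Jgen JO xn; have ge_n := vge_nrd_ideal Jgen; rewrite xn in ge_n.
apply: (val_ideal_min p_prime (y := nrd x) _ _ _ xn ge_n).
- apply/idealP; split; last exact: span_ZK.
  apply: (@span_mul_ind K K^o) => [|a b|s _ Zs [y Jy <-]]; [exact: ZK0 | exact: ZKD|].
  by apply: ZKM => //; apply/ZK_nrd_order/JO.
- exact: nrd_generator.
by case: Jgen.
Qed.

Lemma val_nrd_ideal_unique J x k : generated J x -> val_ideal p (nrd_ideal H J) k ->
  k = v (nrd x).
Proof.
move=> Jgen; apply: (val_ideal_unique p_prime (nrd_generator Jgen)) => //.
  by case: Jgen.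
exact: vge_nrd_ideal.
Qed.

(** Division of [J] by the exact power [p ^ m] that divides its local generator,
    where [J] lies in [O] up to a denominator [p ^ M]. The new generator
    is [x] times an element of [p ^ -m] of exact valuation [-m]. The quotient is
    contained in [O]: locally at [p] because its generator is integral, and
    elsewhere by [localization_descent]. This lemma covers both the
    initialization of the algorithm and the removal of [p] in the passes
    with [b = 1]. *)
Lemma generated_descent J x (m M : nat) Y : generated J x -> primitive_mx Y ->
  coords x = pi ^ m *: Y ->
  (forall q y, pow M q -> J y -> O (q *: y)) ->
  exists x', [/\ generated (span_mul (pow (- m%:Z)) J) x',
    span_mul (pow (- m%:Z)) J `<=` O, primitive_mx (coords x'),
    act phi x' (vertex_of E) = act phi x (vertex_of E) & v (nrd x') = v (nrd x) - m%:Z *+ 2].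
Proof.
move=> [J_lat JO Jx x0 xJ] Yp xE JM; have [t [mt t0 vt]] := pow_elt p_prime Kp (- m%:Z).
have et0 : cemb Kp t != 0 by rewrite emb_neq0.
have tx0 : nrd (t *: x) != 0 by rewrite nrdZ mulf_neq0 // expf_neq0.
exists (t *: x); split.
- split=> //; [exact: lattice_pow | by rewrite right_order_pow | exact: span_mul_gen|].
  have xtx : t *: x = t%:A * x by rewrite mulr_algl.
  have tu : (t%:A : A) \is a GRing.unit by rewrite scaler_unit ?unitr1 ?unitfE.
  apply: (@span_mul_ind _ _ _ _ [set y | integral_mx (coords ((t *: x)^-1 * y))])
    => [|y z|s y ms Jy] /=.
  + by rewrite mulr0 /coords rmorph0 mulmx0 mul0mx => i j; rewrite mxE; left.
  + move=> Hy Hz; rewrite mulrDr /coords rmorphD mulmxDr mulmxDl.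
    exact: integral_mx_add.
  rewrite invrZ ?unitfE ?(nrd_unit x0) // -scalerAl -scalerAr scalerA coordsZ.
  apply: integral_mx_scale; last exact: xJ.
  rewrite rmorphM fmorphV -(addNr (- m%:Z)); apply: val_geM.
    by right; rewrite cvalV // vt.
  exact: vge_pow.
- have [O0 OD OZ] := lattice_ZKmod O_lat.
  apply: span_mul_ind => // s y ms Jy.
  (* Away from [p] it suffices to know that a power of [p] multiplies [s y] into [O]. *)
  apply: (localization_descent p_prime O_lat (m := (M + m)%N)).
    by move=> q /pow_mulN_mem/(_ ms) sq; rewrite scalerA mulrC; apply: JM.
  apply: (local_lattice_denom p_prime p_split O_lat); apply/localP.
  rewrite -[y](mulVKr (nrd_unit x0)) coordsZ coordsM xE -scalemxAl scalerA.
  apply: integral_mx_scale; last by apply: integral_mx_mul; [case: Yp | apply: xJ].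
  rewrite -(addNr m%:Z); apply: val_geM; first exact: vge_pow.
  by right; rewrite cval_unifX.
- rewrite coordsZ xE scalerA; have c0 : cemb Kp t * pi ^ m != 0.
    by rewrite mulf_neq0 ?cunifX_neq0.
  have vc : cval (cemb Kp t * pi ^ m) = 0 by rewrite cvalM ?cunifX_neq0 // vt cval_unifX addNr.
  have [Yi [i [j [Y0 vY]]]] := Yp; split.
    by apply: integral_mx_scale => //; right; rewrite vc.
  by exists i, j; rewrite mxE mulf_neq0 // cvalM // vc vY.
- by rewrite !act_coords coordsZ -scalemxAr vertex_of_scale.
by rewrite nrdZ rmorphM rmorphXn cvalM ?expf_neq0 ?emb_neq0 // cvalXn // vt; lia.
Qed.


Section Loop.
Variables (S : reduction_structure phi H O) (S0 : rsP S false = vertex_of E).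

Lemma act_comp g x P : act phi g (act phi x P) = act phi (g * x) P.
Proof. by rewrite /act actM_comp rmorphM mulmxE. Qed.

Lemma phi_unit g : g \is a GRing.unit -> phi g \in unitmx.
Proof. by move=> gu; have := rmorph_unit phi gu. Qed.

Lemma rsP_vertex b : is_vertex (rsP S b).
Proof. by case: (rsP_fixed S b). Qed.

(** [x] is a local generator of [J] not divisible by [p], and [Q] is its image of the
    base vertex; hence [k] is the distance from the base vertex to [Q]. The distance
    from the other vertex, which matters when [b = 1], is tracked separately. *)
Definition invariant (I : set A) (s : state A Kp) : Prop :=
  (exists x, [/\ generated (stJ s) x, stJ s `<=` O, primitive_mx (coords x),
     v (nrd x) = stk s & stQ s = act phi x (vertex_of E)]) /\
  [/\ stc s \is a GRing.unit, exists n : nat, str s = n &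
     lmul_set (stc s) I = span_mul (pow (str s)) (stJ s)].

Lemma invariant_nat I s : invariant I s -> exists n : nat, stk s = n.
Proof.
move=> [[x [[_ _ _ x0 _] _ [Xi _] <- _]] _].
have := integral_mx_det Xi; rewrite det_coords => /(vge_v x0).
by case: (v _) => // n _; exists n.
Qed.

Lemma mindist_act0 x (n : nat) : primitive_mx (coords x) -> nrd x != 0 -> v (nrd x) = n ->
  mindist (vertex_of E) (act phi x (vertex_of E)) n.
Proof.
move=> xp x0 xn; rewrite act_coords; apply: mindist_prim => //.
  by rewrite det_coords emb_neq0.
by rewrite det_coords.
Qed.

(** This provides the case distinction in [selected]: away from [Q], the chosen
    neighbour lies on the segment. *)
Lemma mindist_neq (P Q : vertex Kp) n : is_vertex P -> mindist P Q n.+1 -> Q <> P.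
Proof.
move=> Pv [_ Qmin] QP; have : walk P Q 0 (fun=> P) by split.
by move/Qmin.
Qed.

Lemma selected_exists s n : mindist (rsP S (stb s)) (stQ s) n.+1 ->
  exists P, selected S s P.
Proof. by move/segment_exists => [P [Pv PP Pseg]]; exists P. Qed.

(** Moving to the selected neighbour decreases the distance to [Q] by one, and the
    element of the reduction structure transports this configuration to the
    other base vertex. *)
Lemma selected_next s P n : mindist (rsP S (stb s)) (stQ s) n.+1 -> selected S s P ->
  mindist (rsP S (~~ stb s)) (act phi (rsg S (stb s) P) (stQ s)) n.
Proof.
move=> Qn [Pv PP Pseg]; rewrite -(rsgP Pv PP).
have [gu _ _] := rsg_units Pv PP; apply: mindist_act; first exact: phi_unit.
apply: (segment_next _ Qn PP); first exact: rsP_vertex.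
by apply/Pseg/mindist_neq/Qn/rsP_vertex.
Qed.

Lemma rsg_left_order b : exists2 N, lattice N & forall P, is_vertex P ->
  distance (rsP S b) P 1 -> left_order N (rsg S b P) /\ left_order N (rsg S b P)^-1.
Proof.
case: b.
  have [N [[N_lat _ _] _ O1E]] := rsO1 S; exists N => // P Pv PP.
  by have [_] := rsg_units Pv PP; rewrite O1E.
exists O => // P Pv PP; have [_] := rsg_units Pv PP; rewrite rsO0 => Og Og'.
by split=> y; apply: OM.
Qed.

Lemma v_rsg b P : is_vertex P -> distance (rsP S b) P 1 ->
  nrd (rsg S b P) != 0 /\ v (nrd (rsg S b P)) = 0.
Proof.
move=> Pv PP; have [gu _ _] := rsg_units Pv PP; have [N N_lat Ng] := rsg_left_order b.
by have [? ?] := Ng P Pv PP; apply: v_nrd_unit N_lat gu _ _.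
Qed.

(** The element [g] is a unit of [O], so [J] stays in [O] and its local generator
    stays primitive. When [k = 0] any neighbour of the base vertex may be chosen, and
    the loop stops after this pass. *)
Lemma pass_even I s : invariant I s -> stb s = false ->
  (exists s', pass S s s') /\
  forall s', pass S s s' -> [/\ invariant I s', stb s' = true, stk s' = stk s &
    forall n : nat, stk s = n.+2 -> mindist (rsP S true) (stQ s') n.+1].
Proof.
move=> sI sb; have [n kn] := invariant_nat sI.
have [[x [Jx JO xp xk Qx]] [cu r_nat cI]] := sI.
have x0 : nrd x != 0 by case: Jx.
have Qn : mindist (rsP S (stb s)) (stQ s) n.
  by rewrite sb S0 Qx; apply: mindist_act0 => //; rewrite xk.
split.
  suff [P sP] : exists P, selected S s P by exists (update S s P), P.
  case: n kn Qn => [|n] _ Qn; last exact: selected_exists Qn.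
  exists (vertex_of (E *m unif_diag Kp 0 1)); split.
  - apply/is_vertexP; exists (E *m unif_diag Kp 0 1) => //.
    by rewrite unitmx_mul Eu unitmxE det_unif_diag unitfE mulf_neq0 ?cunifX_neq0.
  - by rewrite sb S0; apply: distance_unif_diag.
  by have [[w [<- <- _ _]] _] := Qn.
move=> _ [P sP ->]; have [Pv PP _] := sP; have [g0 vg] := v_rsg Pv PP.
have [gu Og Og'] := rsg_units Pv PP.
have next := selected_next _ sP; rewrite /update; rewrite sb in next g0 vg gu Og Og' *.
rewrite rsO0 in Og Og'; set g := rsg S false P in next g0 vg gu Og Og' *.
split=> //=; last first.
  move=> m km; apply: next; rewrite sb in Qn.
  have nm : n = m.+2 by move: kn; rewrite km; lia.
  by rewrite -nm.
split=> /=; last first.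
  split=> //; first by rewrite unitrMr.
  by rewrite -lmul_comp cI lmul_span.
exists (g * x); split=> //.
- exact: generated_lmul.
- by move=> _ [y Jy <-]; apply/OM/JO.
- rewrite coordsM; apply: primitive_mx_mul => //; split; first exact: int_coords.
    by rewrite det_coords emb_neq0.
  by rewrite det_coords.
- by rewrite nrdM vK_eqM // vg add0r.
by rewrite Qx act_comp.
Qed.

(** Now [g] is a unit of the other order. The determinant of the generator still has
    valuation [n + 2], but the distance from the base vertex has become [n]: so the
    generator is divisible by [p] exactly once, and [generated_descent]
    applies with one factor [p], which is also the denominator of [g J]
    by [conductor_left_order]. *)
Lemma pass_odd I s (n : nat) : invariant I s -> stb s = true -> stk s = n.+2 ->
  mindist (rsP S true) (stQ s) n.+1 ->
  (exists s', pass S s s') /\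
  forall s', pass S s s' -> [/\ invariant I s', stb s' = false & stk s' = n].
Proof.
move=> sI sb kn; rewrite -{1}sb => Qn.
have [[x [Jx JO xp xk Qx]] [cu [r rE] cI]] := sI.
have x0 : nrd x != 0 by case: Jx.
split; first by have [P sP] := selected_exists Qn; exists (update S s P), P.
move=> _ [P sP ->]; have [Pv PP _] := sP; have [g0 vg] := v_rsg Pv PP.
have [gu Og _] := rsg_units Pv PP.
have := selected_next Qn sP; rewrite /update; rewrite sb in g0 vg gu Og *.
set g := rsg S true P in g0 vg gu Og *; rewrite S0 Qx act_comp => Q'n.
have gx0 : nrd (g * x) != 0 by rewrite nrdM mulf_neq0.
have vgx : v (nrd (g * x)) = n.+2 by rewrite nrdM vK_eqM // vg add0r xk.
have [m [Y [Yp gxE]]] : exists (m : int) Y, primitive_mx Y /\ coords (g * x) = pi ^ m *: Y.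
  apply: primitive_mx_exists; apply: contra_neq gx0 => /(congr1 determinant).
  by rewrite det_coords det0 => /eqP; rewrite fmorph_eq0 => /eqP.
have pm0 : pi ^ m != 0 := cunifX_neq0 Kp m.
have dY : \det (coords (g * x)) = pi ^ m * pi ^ m * \det Y by rewrite gxE detZ expr2.
have Y0 : \det Y != 0.
  apply: contra_neq gx0 => Y0; apply/eqP.
  by rewrite -(fmorph_eq0 (cemb Kp)) -det_coords dY Y0 mulr0.
(* Compare the valuation of the determinant of [g x] with that of [Y]. *)
have vY : n.+2%:Z = m + m + cval (\det Y).
  by rewrite -vgx -det_coords dY !cvalM ?mulf_neq0 // cval_unifX.
(* The distance [n] is the valuation of the determinant of the primitive part [Y]. *)
have m1 : m = 1.
  have := val_ge_unit Y0 (integral_mx_det (proj1 Yp)).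
  move: vY; case vYk: (cval (\det Y)) => [k|//] vY _.
  have : n = k; last by move: vY; clear; lia.
  apply: mindist_uniq Q'n _; rewrite act_coords gxE -scalemxAr vertex_of_scale //.
  exact: mindist_prim.
have [N [N_id N_p O1E]] := rsO1 S; rewrite O1E in Og.
have [O0 OD OZ] := lattice_ZKmod O_lat.
have [|||x' [Jx' JO' xp' Qx' vx']] :=
    @generated_descent (lmul_set g (stJ s)) (g * x) 1 1 Y _ Yp.
- exact: generated_lmul.
- by rewrite gxE m1.
- rewrite pow1E // => q _ pq [y /JO Oy <-]; rewrite scalerAl; apply: OM => //.
  exact: conductor_left_order N_id N_p pq Og.
split=> //=; last by rewrite kn; clear; lia.
split=> /=.
  by exists x'; split=> //; rewrite vx' vgx kn; clear; lia.
split; first by rewrite unitrMr.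
  by exists r.+1; rewrite rE; clear; lia.
rewrite -lmul_comp cI lmul_span rE.
by rewrite (_ : r%:Z + 1 = (r + 1)%N) //; apply: esym (pow_span_cancel p_prime Kp r 1 _).
Qed.

(** The exponent of the norm of [J] is [k], a natural number. *)
Lemma invariant_post I s : invariant I s -> stk s < 2 ->
  [/\ stc s \is a GRing.unit, integral_right_ideal O (stJ s),
      lmul_set (stc s) I = span_mul (pow (str s)) (stJ s) &
      val_ideal p (nrd_ideal H (stJ s)) 0 \/ val_ideal p (nrd_ideal H (stJ s)) 1].
Proof.
move=> sI k2; have [n kn] := invariant_nat sI.
have [[x [Jx JO _ xk _]] [cu _ cI]] := sI; split=> //.
  by have [J_lat JrO _ _ _] := Jx; split.
have := val_nrd_ideal Jx JO (etrans xk kn).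
have [->|->] : n = 0%N \/ n = 1%N by lia.
  by left.
by right.
Qed.

(** Two passes decrease [k] by 2. *)
Lemma loop_correct_invariant I (s : state A Kp) : invariant I s -> stb s = false ->
  loop_correct S (fun s' => [/\ stc s' \is a GRing.unit, integral_right_ideal O (stJ s'),
      lmul_set (stc s') I = span_mul (pow (str s')) (stJ s') &
      val_ideal p (nrd_ideal H (stJ s')) 0 \/ val_ideal p (nrd_ideal H (stJ s')) 1]) s.
Proof.
have [M] := ubnP `|stk s|%N; elim: M s => [s|M IHM s kM sI sb]; first by rewrite ltn0.
have [ex_s next] := pass_even sI sb.
split; [exact: ex_s | by move=> s' /next[s'I _ _ _]; apply: invariant_post |].
move=> s' /next[s'I sb' kE Qs'] k2.
have [k k_nat] := invariant_nat s'I.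
have [n kn] : exists n : nat, k = n.+2.
  by case: k k_nat => [|[|n]] k_nat; rewrite ?k_nat // in k2 *; exists n.
rewrite kn in k_nat; have [ex_s' next'] := pass_odd s'I sb' k_nat (Qs' n (etrans (esym kE) k_nat)).
split; [exact: ex_s' | by move=> s'' /next'[s''I _ _]; apply: invariant_post |].
move=> s'' /next'[s''I sb'' kE'] _; apply: IHM; [|exact: s''I|exact: sb''].
by rewrite kE'; rewrite -kE k_nat in kM; move: kM; clear; lia.
Qed.

Section Start.
Variables (LG : set A -> A) (LG_spec : local_generator phi O LG).
Variables (I : set A) (I_ideal : integral_right_ideal O I).

(** The norm of the generator is nonzero, for a row vector killed by its
    matrix would be killed by the image of the whole algebra. *)
Lemma local_generator_generated : generated I (LG I).
Proof.
have [I_lat IrO IO] := I_ideal; have [Ix xI] := LG_spec I_ideal.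
have Iphi y : I y -> exists2 m, local_lattice phi O m & phi y = phi (LG I) *m m.
  move=> Iy; have : local_lattice phi I (phi y).
    by rewrite -[phi y]scale1r; apply: span_mul_gen; [exact: val_ge1 | exists y].
  by rewrite xI => -[m Om <-]; exists m.
have x0 : nrd (LG I) != 0.
  rewrite -emb_neq0 -det_phi; apply/negP => /det0P[w w0 wx].
  have wI y : I y -> w *m phi y = 0.
    by move=> /Iphi[m _ ->]; rewrite mulmxA wx mul0mx.
  suff wA : span_mul setT I `<=` [set y | w *m phi y = 0].
    have I1 : span_mul setT I 1 by case: I_lat => _ ->.
    by have := wA _ I1; rewrite /= rmorph1 mulmx1 => /eqP; rewrite (negPf w0).
  apply: span_mul_ind => [|y z|s y _ /wI wy] /=.
  - by rewrite rmorph0 mulmx0.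
  - by rewrite rmorphD mulmxDr => -> ->; rewrite addr0.
  by rewrite phiZ -scalemxAr wy scaler0.
split=> // y /Iphi[m Om yE]; apply/localP.
rewrite rmorphM yE -mulmxE mulmxA -[_ *m phi (LG I)]rmorphM mulVr ?(nrd_unit x0) //.
by rewrite rmorph1 mul1mx.
Qed.

(** The largest [r] is the content of the local generator: [generated_descent] shows
    that this content is allowed, and the generator itself prevents any
    larger exponent. *)
Lemma initial_content : exists (m : nat) Y,
  [/\ primitive_mx Y, coords (LG I) = pi ^ m *: Y, I `<=` span_mul (pow m) O &
      forall r, I `<=` span_mul (pow r) O -> r <= m].
Proof.
have [I_lat IrO IO] := I_ideal; have Igen := local_generator_generated.
have [_ _ Ix x0 _] := Igen; have [O0 OD OZ] := lattice_ZKmod O_lat.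
have [m [Y [Yp xE]]] : exists (m : int) Y, primitive_mx Y /\ coords (LG I) = pi ^ m *: Y.
  apply: primitive_mx_exists; apply: contra_neq x0 => /(congr1 determinant).
  by rewrite det_coords det0 => /eqP; rewrite fmorph_eq0 => /eqP.
have m_max r : I `<=` span_mul (pow r) O -> r <= m.
  move=> /(_ _ Ix) rx; rewrite -subr_ge0 -(cval_unifX Kp (m - r)).
  apply: primitive_mx_scale Yp _; first exact: cunifX_neq0.
  have -> : pi ^ (m - r) *: Y = pi ^ (- r) *: coords (LG I).
    by rewrite xE scalerA -expfzDr ?cunif_neq0 // addrC.
  move: (LG I) rx; apply: (@span_mul_ind _ _ _ _ [set x | integral_mx (pi ^ (- r) *: coords x)])
    => [|x y|q y rq Oy] /=.
  - by rewrite /coords rmorph0 mulmx0 mul0mx scaler0 => i j; rewrite mxE; left.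
  - by move=> Hx Hy; rewrite /coords rmorphD mulmxDr mulmxDl scalerDr; apply: integral_mx_add.
  rewrite coordsZ scalerA; apply: integral_mx_scale; last exact: int_coords.
  by rewrite -(addNr r); apply: val_geM; [right; rewrite cval_unifX | apply: vge_pow].
have m0 : 0 <= m.
  by apply: m_max => y /IO Oy; rewrite span_ZK_id //; apply: lattice_ZKmod.
case: m m0 xE m_max => // m _ xE m_max; exists m, Y; split=> // y.
have [|x' [_ IO' _ _ _]] := generated_descent (M := 0) Igen Yp xE.
  by move=> q z Zq /IO Oz; apply: OZ.
rewrite -{1}(pow_span_cancel0 p_prime Kp m I_lat).
by apply: span_mul_sub => // z; apply: IO'.
Qed.

Lemma initial_exists : exists s, initial S LG I s.
Proof.
have [m [Y [Yp xE Im m_max]]] := initial_content; have [I_lat IrO IO] := I_ideal.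
have [O0 OD OZ] := lattice_ZKmod O_lat.
have [|x' [gen' IO' xp' _ _]] := generated_descent (M := 0) local_generator_generated Yp xE.
  by move=> q z Zq /IO Oz; apply: OZ.
have := integral_mx_det (proj1 xp'); rewrite det_coords => /vge_v vx'.
have {}vx' : 0 <= v (nrd x') by apply: vx'; case: gen'.
case vE : (v (nrd x')) vx' => [k|//] _.
exists (State (span_mul (pow (- m%:Z)) I) 1 m k false (act phi (LG I) (rsP S false))).
by exists m, k; split=> //; apply: val_nrd_ideal gen' IO' vE.
Qed.

Lemma initial_invariant s : initial S LG I s -> invariant I s /\ stb s = false.
Proof.
move=> [r [k [/= Ir r_max valk ->]]]; split=> //.
have [m [Y [Yp xE Im m_max]]] := initial_content; have [I_lat IrO IO] := I_ideal.
have [O0 OD OZ] := lattice_ZKmod O_lat.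
have rm : r = m by apply/eqP; rewrite eq_le (m_max _ Ir) (r_max _ Im).
subst r.
have [|x' [gen' IO' xp' Qx' vx']] := generated_descent (M := 0) local_generator_generated Yp xE.
  by move=> q z Zq /IO Oz; apply: OZ.
split=> /=.
  exists x'; split=> //; first by rewrite (val_nrd_ideal_unique gen' valk).
  by rewrite S0 Qx'.
split; [exact: unitr1 | by exists m|].
by rewrite lmul1 (pow_span_cancel0 p_prime Kp).
Qed.

End Start.
End Loop.
End Fixed.
End Reduction.

Theorem proposition3p10 (R : realType) (K : fieldExtType rat) (A : falgType K)
    (H : quaternion_algebra A) (Aindef : indefinite A R)
    (O : set A) (Omax : maximal_order O)
    (p : set K) (p_prime : prime_ideal p)
    (Kp : completion p) (phi : {rmorphism A -> 'M[Kp]_2})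
    (p_split : splitting (cemb Kp) phi)
    (S : reduction_structure phi H O)
    (LG : set A -> A) (LG_spec : local_generator phi O LG)
    (I : set A) (I_ideal : integral_right_ideal O I) :
  PReduce_correct S LG
    (fun (J : set A) (c : A) (r : int) =>
       [/\ c \is a GRing.unit,
           integral_right_ideal O J,
           lmul_set c I = span_mul (pow_ideal p r) J
         & val_ideal p (nrd_ideal H J) 0 \/ val_ideal p (nrd_ideal H J) 1])
    I.
Proof.
have O_order := proj1 Omax.
have := rsP_fixed S false; rewrite rsO0 => P0_fixed.
have /is_vertexP[E Eu S0] := proj1 P0_fixed; rewrite S0 in P0_fixed.
split; first exact: (initial_exists O_order p_prime p_split Eu P0_fixed S LG_spec I_ideal).
move=> s /(initial_invariant O_order p_prime p_split Eu P0_fixed S0 LG_spec I_ideal)[sI sb].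
exact: (loop_correct_invariant O_order p_prime p_split Eu P0_fixed S0 sI sb).
Qed.
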